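(* Let $K/\mathbb{Q}$ be an algebraic field extension and let $\phi:\mathcal{M}_K\to\mathcal{M}_K$ be a continuous ring endomorphism. Then at least one of the following holds. (1) There exist integers $k,s\ge 0$ and $\sigma\in\mathrm{Gal}(K/\mathbb{Q})$ such that for every monic polynomial $\prod_i(x-\alpha_i)\in K[x]$ (with $\alpha_i\in\overline K$) $$\phi\Big(\Big[\prod_i (x-\alpha_i)\Big]\Big)=\Big[x^{\sum_i(\alpha_i^s-1)}\cdot\prod_i\big(x-\sigma(\alpha_i)^k\big)\Big].$$ (2) All roots of rational functions in the image of $\phi$ are roots of unity. Moreover, if $K/\mathbb{Q}$ is finite, then there exists $N\geq 1$ such that all these roots are $N$th roots of unity.
   Context: For a field $K$ with algebraic closure $\overline K$, $\mathcal{M}_K$ is the ring whose elements are the rational functions $h\in K(x)$ that are ratios of monic polynomials in $K[x]$; write $[h]$ for the corresponding element. Addition is multiplication of rational functions, $[h]+[h']=[hh']$. Multiplication is the biadditive operation with $[\prod_i(x-\alpha_i)]\cdot[\prod_j(x-\beta_j)]=[\prod_{i,j}(x-\alpha_i\beta_j)]$ (roots in $\overline K$, with multiplicity); the unit is $[x-1]$. Ring homomorphisms are unital. For each integer $k\ge 0$, $t_k:\mathcal{M}_K\to K$ is the ring homomorphism determined by $t_k([\prod_i(x-\alpha_i)])=\sum_i\alpha_i^k$, with $0^0=1$. The topology on $\mathcal{M}_K$ is induced by $(t_k)_{k\ge 0}:\mathcal{M}_K\to\prod_{k\ge 0}K$, where each $K$ is discrete and the product has the product topology. $\mathrm{Gal}(K/\mathbb{Q})$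 is the group of field automorphisms of $K$. When the $\alpha_i$ are not in $K$, $\sigma(\alpha_i)$ is computed using any extension of $\sigma$ to an automorphism of $\overline K$; the product over all roots does not depend on the choice. The formula in (1) includes the assertion that the exponent $\sum_i(\alpha_i^s-1)$ is an integer. The convention $0^0=1$ is used. The roots of a rational function are its zeros and poles in $\overline K$ when written in lowest terms. *)

(* Defs.v *)
From HB Require Import structures.
From mathcomp Require Import all_boot all_order all_algebra.
From mathcomp Require Import all_classical.
From mathcomp Require Import topology_structure initial_topology.
From mathcomp Require Import discrete_topology function_spaces.

Set Implicit Arguments.
Unset Strict Implicit.
Unset Printing Implicit Defensive.

Import GRing.Theory.
Local Open Scope classical_set_scope.
Local Open Scope ring_scope.

Notation "x %:F" := (tofrac x) : ring_scope.

(* Throughout, [iota : K -> L] is an embedding of K into an algebraically     *)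
(* closed field L playing the role of an algebraic closure of K.              *)
Section Roots.
Context {K : fieldType} {L : closedFieldType} (iota : {rmorphism K -> L}).

(* The roots of p in L, with multiplicity (meaningful for p != 0).            *)
Definition alg_roots (p : {poly K}) : seq L :=
  sval (closed_field_poly_normal (map_poly iota p)).

Lemma alg_rootsE p : p \is monic ->
  map_poly iota p = \prod_(a <- alg_roots p) ('X - a%:P).
Proof.
move=> mp; rewrite /alg_roots; case: closed_field_poly_normal => r /= {1}->.
by rewrite lead_coef_map (monicP mp) rmorph1 scale1r.
Qed.

Lemma alg_roots_perm p s : p \is monic ->
  map_poly iota p = \prod_(a <- s) ('X - a%:P) -> perm_eq (alg_roots p) s.
Proof. by move=> mp pE; apply: prod_XsubC_eq; rewrite -alg_rootsE. Qed.

Lemma alg_roots_mul p q : p \is monic -> q \is monic ->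
  perm_eq (alg_roots (p * q)) (alg_roots p ++ alg_roots q).
Proof.
move=> mp mq; apply: alg_roots_perm; first by rewrite monicMl.
by rewrite rmorphM /= !alg_rootsE // big_cat.
Qed.

Lemma alg_roots1 : alg_roots 1 = [::].
Proof.
apply/perm_nilP; apply: alg_roots_perm; first exact: monic1.
by rewrite rmorph1 big_nil.
Qed.

Lemma alg_rootsX1 : perm_eq (alg_roots ('X - 1)) [:: 1].
Proof.
rewrite -polyC1; apply: alg_roots_perm; first exact: monicXsubC.
by rewrite rmorphB /= map_polyX map_polyC /= rmorph1 big_seq1.
Qed.

Lemma monic_of_map (r : {poly K}) : map_poly iota r \is monic -> r \is monic.
Proof.
move=> /monicP; rewrite lead_coef_map => h; apply/monicP.
by apply: (fmorph_inj iota); rewrite rmorph1.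
Qed.

(* The polynomial over K with roots a * b, for a (resp. b) a root of p        *)
(* (resp. q); lemma starE shows that it exists.                               *)
Definition star (p q : {poly K}) : {poly K} :=
  xget 1 [set r | map_poly iota r =
    \prod_(a <- alg_roots p) \prod_(b <- alg_roots q) ('X - (a * b)%:P)].

Section Homogenize.
Variables (R : comNzRingType) (m : nat) (D : 'M[R]_m) (x : R).

Definition hom_eval n (p : nat -> R) : 'M[R]_m :=
  \sum_(i < n.+1) (p i * x ^+ i) *: D ^+ (n - i).

Lemma hom_evalM (n : nat) (p q : nat -> R) (a : R) : p n.+1 = 0 ->
  (forall i, q i = (if i is j.+1 then p j else 0) - a * p i) ->
  hom_eval n.+1 q = (x%:M - a *: D) *m hom_eval n p.
Proof.
move=> pn qE; rewrite mulmxBl mul_scalar_mx -scalemxAl.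
rewrite /hom_eval mulmx_sumr !scaler_sumr.
under eq_bigr => i _ do rewrite qE mulrBl scalerBl.
rewrite sumrB; congr (_ - _).
  rewrite big_ord_recl /= mul0r scale0r add0r.
  apply: eq_bigr => i _; rewrite /= /bump /= add1n subSS scalerA.
  by rewrite exprS mulrCA.
rewrite big_ord_recr /= pn mulr0 mul0r scale0r addr0.
apply: eq_bigr => i _; rewrite -scalemxAr scalerA mulrA.
by rewrite subSn ?exprS // -ltnS.
Qed.
End Homogenize.

Lemma star_exists p q : p \is monic -> q \is monic -> exists r : {poly K},
  map_poly iota r =
    \prod_(a <- alg_roots p) \prod_(b <- alg_roots q) ('X - (a * b)%:P).
Proof.
move=> mp mq; set C := companionmx q.
pose n := (size p).-1.
exists (\det (hom_eval (map_mx polyC C) 'X n (fun i => (p`_i)%:P))).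
rewrite -det_map_mx.
set D := map_mx iota C; set D' := map_mx polyC D.
have -> : map_mx (map_poly iota)
    (hom_eval (map_mx polyC C) 'X n (fun i => (p`_i)%:P)) =
    hom_eval D' 'X n (fun i => ((map_poly iota p)`_i)%:P).
  rewrite /hom_eval map_mx_sum; apply: eq_bigr => i _.
  rewrite map_mxZ rmorphM /= map_polyC /= rmorphXn /= map_polyX coef_map /=.
  congr (_ *: _); rewrite rmorphXn /=; congr (_ ^+ _).
  by rewrite /D' /D -!map_mx_comp; apply: eq_map_mx => u /=; rewrite map_polyC.
have charD : char_poly D = \prod_(b <- alg_roots q) ('X - b%:P).
  by rewrite /D -map_char_poly companionmxK // alg_rootsE.
have factor a : \det ('X%:M - a%:P *: D') =
    \prod_(b <- alg_roots q) ('X - (a * b)%:P).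
  have sz : size (alg_roots q) = (size q).-1.
    by rewrite -(size_map_poly iota q) alg_rootsE // size_prod_XsubC.
  have [->|a0] := eqVneq a 0.
    rewrite scale0r subr0 det_scalar -sz.
    under eq_bigr => b _ do rewrite mul0r subr0.
    by rewrite big_const_seq count_predT iter_mulr mulr1.
  have -> : 'X%:M - a%:P *: D' =
      a%:P *: map_mx (comp_poly (a^-1 *: 'X)) (char_poly_mx D).
    rewrite /char_poly_mx map_mxB scalerBr; congr (_ - _).
      rewrite map_scalar_mx /= comp_polyX scale_scalar_mx.
      by rewrite -mul_polyC mulrA -polyCM divff // mul1r.
    congr (_ *: _); rewrite -map_mx_comp; apply: eq_map_mx => u /=.
    by rewrite comp_polyC.
  rewrite detZ det_map_mx -/(char_poly D) charD rmorph_prod /=.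
  rewrite -[X in _ ^+ X]sz -(mulr1 (_ ^+ _)) -(count_predT (alg_roots q)).
  rewrite -iter_mulr.
  rewrite -big_const_seq -big_split /=; apply: eq_bigr => b _.
  rewrite comp_polyB comp_polyX comp_polyC mulrBr -mul_polyC mulrA -!polyCM.
  by rewrite divff // mul1r.
have main (s : seq L) (f : {poly L}) : f = \prod_(a <- s) ('X - a%:P) ->
    hom_eval D' 'X (size s) (fun i => (f`_i)%:P) =
    \big[mulmx/1%:M]_(a <- s) ('X%:M - a%:P *: D').
  elim: s f => [|a s IHs] f ->.
    rewrite !big_nil /hom_eval big_ord1 /= coef1 /= expr0 mulr1 scale1r.
    by rewrite expr0.
  rewrite [RHS]big_cons -(IHs _ erefl) big_cons /=.
  apply: hom_evalM => [|i].
    by rewrite nth_default ?size_prod_XsubC.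
  rewrite mulrBl coefB coefXM coefCM polyCB polyCM.
  by case: i => [|i].
have sp : n = size (alg_roots p).
  by rewrite /n -(size_map_poly iota p) alg_rootsE // size_prod_XsubC.
rewrite sp (main _ _ (alg_rootsE mp)).
rewrite (big_morph _ (@det_mulmx _ _) (det1 _ _)).
by apply: eq_bigr => a _; rewrite factor.
Qed.

Lemma starE p q : p \is monic -> q \is monic ->
  map_poly iota (star p q) =
    \prod_(a <- alg_roots p) \prod_(b <- alg_roots q) ('X - (a * b)%:P).
Proof. by move=> mp mq; apply: (xgetPex 1 (star_exists mp mq)). Qed.

Lemma starE' p q : p \is monic -> q \is monic ->
  map_poly iota (star p q) =
    \prod_(c <- [seq a * b | a <- alg_roots p, b <- alg_roots q]) ('X - c%:P).
Proof.
move=> mp mq; rewrite starE // big_allpairs_dep.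
by apply: eq_bigr.
Qed.

Lemma star_monic p q : p \is monic -> q \is monic -> star p q \is monic.
Proof.
by move=> mp mq; apply: monic_of_map; rewrite starE' // monic_prod_XsubC.
Qed.

Lemma star_roots p q : p \is monic -> q \is monic ->
  perm_eq (alg_roots (star p q))
          [seq a * b | a <- alg_roots p, b <- alg_roots q].
Proof.
by move=> mp mq; apply: alg_roots_perm; [exact: star_monic | exact: starE'].
Qed.

Lemma star_uniq p q r : p \is monic -> q \is monic ->
  map_poly iota r =
    \prod_(a <- alg_roots p) \prod_(b <- alg_roots q) ('X - (a * b)%:P) ->
  star p q = r.
Proof.
by move=> mp mq rE; apply: (map_poly_inj iota); rewrite rE starE.
Qed.

Lemma starC p q : p \is monic -> q \is monic -> star p q = star q p.
Proof.
move=> mp mq; apply: star_uniq => //; rewrite starE // exchange_big /=.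
by apply: eq_bigr => a _; apply: eq_bigr => b _; rewrite mulrC.
Qed.

Lemma starMl p p' q : p \is monic -> p' \is monic -> q \is monic ->
  star (p * p') q = star p q * star p' q.
Proof.
move=> mp mp' mq; apply: star_uniq => //; first by rewrite monicMl.
by rewrite rmorphM /= !starE // (perm_big _ (alg_roots_mul mp mp')) big_cat.
Qed.

Lemma star1l q : q \is monic -> star 1 q = 1.
Proof.
move=> mq; apply: star_uniq => //; first exact: monic1.
by rewrite rmorph1 alg_roots1 big_nil.
Qed.

Lemma starX1l q : q \is monic -> star ('X - 1) q = q.
Proof.
move=> mq; apply: star_uniq => //; first by rewrite -polyC1 monicXsubC.
rewrite (perm_big _ alg_rootsX1) big_seq1 alg_rootsE //.
by under [RHS]eq_bigr do rewrite mul1r.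
Qed.

Lemma starA p q r : p \is monic -> q \is monic -> r \is monic ->
  star p (star q r) = star (star p q) r.
Proof.
move=> mp mq mr; apply: star_uniq => //; first exact: star_monic.
rewrite starE ?star_monic // (perm_big _ (star_roots mp mq)).
rewrite big_allpairs_dep; apply: eq_bigr => a _.
rewrite (perm_big _ (star_roots mq mr)) big_allpairs_dep.
by apply: eq_bigr => b _; apply: eq_bigr => c _; rewrite mulrA.
Qed.

(* The sum of the k-th powers of the roots of p, as an element of K.          *)
Definition power_sum (k : nat) (p : {poly K}) : K :=
  xget 0 [set c | iota c = \sum_(a <- alg_roots p) a ^+ k].

Lemma deriv_prod_XsubC (s : seq L) :
  (\prod_(a <- s) ('X - a%:P))^`() =
  \sum_(a <- s) \prod_(b <- rem a s) ('X - b%:P).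
Proof.
elim: s => [|a s IHs]; first by rewrite !big_nil derivC.
rewrite !big_cons derivM derivXsubC mul1r IHs /= eqxx; congr (_ + _).
rewrite mulr_sumr !big_seq; apply: eq_bigr => b bs.
have [eba|_] := eqVneq b a; last by rewrite big_cons.
rewrite eba in bs *.
have := perm_big _ (perm_to_rem bs) => /(_ _ _ _ xpredT) ->.
by rewrite big_cons.
Qed.

Lemma power_sum_exists k p : p \is monic ->
  exists c, iota c = \sum_(a <- alg_roots p) a ^+ k.
Proof.
move=> mp; set s := alg_roots p.
pose P k := \sum_(a <- s) (a ^+ k) *: \prod_(b <- rem a s) ('X - b%:P).
have Pcoef j : (P j)`_(size s).-1 = \sum_(a <- s) a ^+ j.
  rewrite coef_sum big_seq [RHS]big_seq; apply: eq_bigr => a sa.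
  rewrite coefZ -(size_rem sa).
  have /monicP := monic_prod_XsubC (rem a s) xpredT id.
  by rewrite lead_coefE size_prod_XsubC /= => ->; rewrite mulr1.
suff [Q QE] : exists Q : {poly K}, map_poly iota Q = P k.
  by exists Q`_(size s).-1; rewrite -coef_map QE Pcoef.
elim: k => [|k [Q QE]].
  exists p^`(); rewrite -deriv_map alg_rootsE // deriv_prod_XsubC.
  by apply: eq_bigr => a _; rewrite expr0 scale1r.
exists ('X * Q - Q`_(size s).-1 *: p).
rewrite rmorphB rmorphM /= map_polyX map_polyZ /= -coef_map QE Pcoef.
rewrite alg_rootsE // -/s mulr_sumr scaler_suml -sumrB /P big_seq [RHS]big_seq.
apply: eq_bigr => a sa; rewrite (perm_big _ (perm_to_rem sa)) big_cons /=.
set B := \prod_(_ <- _) _.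
rewrite -scalerAr -scalerBr mulrBl opprB addrC subrK mul_polyC scalerA.
by rewrite exprSr.
Qed.

Lemma power_sumE k p : p \is monic ->
  iota (power_sum k p) = \sum_(a <- alg_roots p) a ^+ k.
Proof. by move=> mp; apply: (xgetPex 0 (power_sum_exists k mp)). Qed.

Lemma power_sumM k p q : p \is monic -> q \is monic ->
  power_sum k (p * q) = power_sum k p + power_sum k q.
Proof.
move=> mp mq; apply: (fmorph_inj iota).
rewrite rmorphD /= !power_sumE ?monicMl //.
by rewrite (perm_big _ (alg_roots_mul mp mq)) big_cat.
Qed.

Lemma power_sum_star k p q : p \is monic -> q \is monic ->
  power_sum k (star p q) = power_sum k p * power_sum k q.
Proof.
move=> mp mq; apply: (fmorph_inj iota).
rewrite rmorphM /= !power_sumE ?star_monic //.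
rewrite (perm_big _ (star_roots mp mq)) big_allpairs_dep mulr_suml.
apply: eq_bigr => a _; rewrite mulr_sumr.
by apply: eq_bigr => b _; rewrite exprMn.
Qed.

Lemma power_sumX1 k : power_sum k ('X - 1) = 1.
Proof.
apply: (fmorph_inj iota); rewrite power_sumE; last first.
  by rewrite -polyC1 monicXsubC.
by rewrite (perm_big _ alg_rootsX1) big_seq1 expr1n rmorph1.
Qed.

End Roots.

Definition monic_ratio {K : fieldType} (h : {fraction {poly K}}) : Prop :=
  exists p q : {poly K}, [/\ p \is monic, q \is monic & h = p%:F / q%:F].

(* The ring M_K; [iota] is a phantom parameter, used by the multiplication.   *)
Record Mring {K : fieldType} {L : closedFieldType}
    (iota : {rmorphism K -> L}) : Type := MkMring {
  ratfun : {fraction {poly K}};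
  _ : `[< monic_ratio ratfun >]
}.

HB.instance Definition _ (K : fieldType) (L : closedFieldType)
  (iota : {rmorphism K -> L}) := [isSub for @ratfun K L iota].
HB.instance Definition _ (K : fieldType) (L : closedFieldType)
  (iota : {rmorphism K -> L}) := [Choice of Mring iota by <:].

Section MringTheory.
Context {K : fieldType} {L : closedFieldType} (iota : {rmorphism K -> L}).
Local Notation M := (Mring iota).

Lemma tofrac_monic_neq0 (p : {poly K}) : p \is monic -> p%:F != 0.
Proof. by move=> mp; rewrite tofrac_eq0 monic_neq0. Qed.

Lemma monic_ratioM (g h : {fraction {poly K}}) :
  monic_ratio g -> monic_ratio h -> monic_ratio (g * h).
Proof.
move=> [p [q [mp mq ->]]] [p' [q' [mp' mq' ->]]].
exists (p * p'), (q * q'); split; rewrite ?monicMl //.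
by rewrite !rmorphM /= invfM mulrACA.
Qed.

Lemma monic_ratioV (h : {fraction {poly K}}) :
  monic_ratio h -> monic_ratio h^-1.
Proof. by move=> [p [q [mp mq ->]]]; exists q, p; split; rewrite ?invf_div. Qed.

Lemma monic_ratio1 : monic_ratio (1 : {fraction {poly K}}).
Proof. by exists 1, 1; rewrite monic1 rmorph1 divr1. Qed.

Lemma monic_ratioF (p : {poly K}) : p \is monic -> monic_ratio p%:F.
Proof. by exists p, 1; rewrite monic1 rmorph1 divr1. Qed.

Lemma ratfunP (h : M) : monic_ratio (ratfun h).
Proof. by case: h => h /= /asboolP. Qed.

Lemma ratfun_neq0 (h : M) : ratfun h != 0.
Proof.
have [p [q [mp mq ->]]] := ratfunP h.
by rewrite mulf_neq0 ?invr_eq0 ?tofrac_monic_neq0.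
Qed.

Definition Madd (g h : M) : M :=
  MkMring iota (asboolT (monic_ratioM (ratfunP g) (ratfunP h))).
Definition Mopp (h : M) : M := MkMring iota (asboolT (monic_ratioV (ratfunP h))).
Definition Mzero : M := MkMring iota (asboolT monic_ratio1).

Lemma MaddA : associative Madd.
Proof. by move=> x y z; apply: val_inj; rewrite /= mulrA. Qed.
Lemma MaddC : commutative Madd.
Proof. by move=> x y; apply: val_inj; rewrite /= mulrC. Qed.
Lemma Madd0 : left_id Mzero Madd.
Proof. by move=> x; apply: val_inj; rewrite /= mul1r. Qed.
Lemma MaddN : left_inverse Mzero Mopp Madd.
Proof. by move=> x; apply: val_inj; rewrite /= mulVf // ratfun_neq0. Qed.

End MringTheory.

HB.instance Definition _ (K : fieldType) (L : closedFieldType)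
    (iota : {rmorphism K -> L}) :=
  GRing.isZmodule.Build (Mring iota)
    (@MaddA K L iota) (@MaddC K L iota) (@Madd0 K L iota) (@MaddN K L iota).

Section MringMul.
Context {K : fieldType} {L : closedFieldType} (iota : {rmorphism K -> L}).
Local Notation M := (Mring iota).

(* [h], meaningful for h a ratio of monic polynomials.                        *)
Definition cls (h : {fraction {poly K}}) : M := insubd (Mzero iota) h.

Lemma ratfun_cls h : monic_ratio h -> ratfun (cls h) = h.
Proof. by move=> mh; rewrite /cls val_insubd; case: asboolP. Qed.

Lemma ratfun_inj : injective (@ratfun K L iota).
Proof. exact: val_inj. Qed.

Lemma clsK (h : M) : cls (ratfun h) = h.
Proof. by apply: ratfun_inj; rewrite ratfun_cls //; exact: ratfunP. Qed.

Lemma ratfunD (g h : M) : ratfun (g + h) = ratfun g * ratfun h.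
Proof. by []. Qed.
Lemma ratfunN (h : M) : ratfun (- h) = (ratfun h)^-1.
Proof. by []. Qed.
Lemma ratfun0 : ratfun (0 : M) = 1.
Proof. by []. Qed.

Lemma clsM g h : monic_ratio g -> monic_ratio h -> cls (g * h) = cls g + cls h.
Proof.
move=> mg mh; apply: ratfun_inj; rewrite ratfunD !ratfun_cls //.
exact: monic_ratioM.
Qed.

Lemma cls1 : cls 1 = 0.
Proof. by apply: ratfun_inj; rewrite ratfun_cls //; exact: monic_ratio1. Qed.

Lemma clsV h : monic_ratio h -> cls h^-1 = - cls h.
Proof.
move=> mh; apply: ratfun_inj; rewrite ratfunN !ratfun_cls //.
exact: monic_ratioV.
Qed.

(* The numerator and denominator of h written in lowest terms.                *)
Definition lowest_terms (h : M) : {poly K} * {poly K} :=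
  xget (1, 1) [set pq | [/\ pq.1 \is monic, pq.2 \is monic,
    coprimep pq.1 pq.2 & ratfun h = pq.1%:F / pq.2%:F]].
Definition Mnum h := (lowest_terms h).1.
Definition Mden h := (lowest_terms h).2.

Lemma lowest_termsP (h : M) : [/\ Mnum h \is monic, Mden h \is monic,
  coprimep (Mnum h) (Mden h) & ratfun h = (Mnum h)%:F / (Mden h)%:F].
Proof.
rewrite /Mnum /Mden.
apply: (@xgetPex _ (1, 1) [set pq | [/\ pq.1 \is monic, pq.2 \is monic,
    coprimep pq.1 pq.2 & ratfun h = pq.1%:F / pq.2%:F]]).
have [p [q [mp mq hE]]] := ratfunP h.
pose g := gcdp p q; pose c := lead_coef g.
have c0 : c != 0.
  by rewrite lead_coef_eq0 gcdp_eq0 negb_and monic_neq0.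
pose p' := c *: (p %/ g); pose q' := c *: (q %/ g).
have pE : p = p' * (c^-1 *: g).
  by rewrite -scalerAl -scalerAr scalerA divff // scale1r divpK // dvdp_gcdl.
have qE : q = q' * (c^-1 *: g).
  by rewrite -scalerAl -scalerAr scalerA divff // scale1r divpK // dvdp_gcdr.
have mg : c^-1 *: g \is monic by rewrite monicE lead_coefZ mulVf.
have mp' : p' \is monic by rewrite -(monicMr _ mg) -pE.
have mq' : q' \is monic by rewrite -(monicMr _ mg) -qE.
exists (p', q'); split => //=.
  by rewrite coprimepZl // coprimepZr // coprimep_div_gcd // monic_neq0.
rewrite hE {1}pE {1}qE !rmorphM /= -mulf_div divff ?mulr1 //.
exact: tofrac_monic_neq0.
Qed.

Lemma Mring_decomp (h : M) : h = cls (Mnum h)%:F - cls (Mden h)%:F.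
Proof.
have [mp mq _ hE] := lowest_termsP h.
apply: ratfun_inj; rewrite ratfunD ratfunN !ratfun_cls //; exact: monic_ratioF.
Qed.

End MringMul.

(* The biadditive extension of [p] * [q] = [star p q].                        *)
HB.lock Definition Mmul {K : fieldType} {L : closedFieldType}
    (iota : {rmorphism K -> L}) (g h : Mring iota) : Mring iota :=
  let s p q := cls iota (star iota p q)%:F in
  s (Mnum g) (Mnum h) + s (Mden g) (Mden h)
  - s (Mnum g) (Mden h) - s (Mden g) (Mnum h).

Section MringMulTheory.
Context {K : fieldType} {L : closedFieldType} (iota : {rmorphism K -> L}).
Local Notation M := (Mring iota).
Local Notation cls := (cls iota).
Local Notation Mmul := (@Mmul K L iota).

Lemma Mring_ext (V : zmodType) (f : {poly K} -> V) :
    (forall p q, p \is monic -> q \is monic -> f (p * q) = f p + f q) ->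
  forall p q, p \is monic -> q \is monic ->
  f (Mnum (cls p%:F - cls q%:F)) - f (Mden (cls p%:F - cls q%:F)) = f p - f q.
Proof.
move=> fM p q mp mq; set h := cls p%:F - _.
have [mn md _ hE] := lowest_termsP h.
have : ratfun h = p%:F / q%:F.
  by rewrite ratfunD ratfunN !ratfun_cls //; exact: monic_ratioF.
rewrite hE => /eqP; rewrite eqr_div ?tofrac_monic_neq0 // -!rmorphM tofrac_eq.
move=> /eqP/(congr1 f); rewrite !fM // => e.
by apply/eqP; rewrite subr_eq addrAC -e addrK.
Qed.

Lemma cls_starMl p p' q : p \is monic -> p' \is monic -> q \is monic ->
  cls (star iota (p * p') q)%:F = cls (star iota p q)%:F + cls (star iota p' q)%:F.
Proof.
move=> mp mp' mq; rewrite starMl // rmorphM /= clsM //;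
  by apply: monic_ratioF; apply: star_monic.
Qed.

Lemma cls_starMr p q q' : p \is monic -> q \is monic -> q' \is monic ->
  cls (star iota p (q * q'))%:F = cls (star iota p q)%:F + cls (star iota p q')%:F.
Proof.
move=> mp mq mq'; rewrite starC ?monicMl // cls_starMl //.
by rewrite !(starC iota mp).
Qed.

Lemma MmulBB p q p' q' :
  p \is monic -> q \is monic -> p' \is monic -> q' \is monic ->
  Mmul (cls p%:F - cls q%:F) (cls p'%:F - cls q'%:F) =
  cls (star iota p p')%:F + cls (star iota q q')%:F
  - cls (star iota p q')%:F - cls (star iota q p')%:F.
Proof.
move=> mp mq mp' mq'; rewrite Mmul.unlock.
set g := cls p%:F - _; set h := cls p'%:F - _.
have [mn md _ _] := lowest_termsP g; have [mn' md' _ _] := lowest_termsP h.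
have E1 r : r \is monic ->
    cls (star iota (Mnum g) r)%:F - cls (star iota (Mden g) r)%:F =
    cls (star iota p r)%:F - cls (star iota q r)%:F.
  move=> mr; apply: (@Mring_ext _ (fun p => cls (star iota p r)%:F)) => //.
  by move=> u v mu mv; apply: cls_starMl.
have E2 r : r \is monic ->
    cls (star iota r (Mnum h))%:F - cls (star iota r (Mden h))%:F =
    cls (star iota r p')%:F - cls (star iota r q')%:F.
  move=> mr; apply: (@Mring_ext _ (fun p => cls (star iota r p)%:F)) => //.
  by move=> u v mu mv; apply: cls_starMr.
have swap (a b c d : M) : a + b - c - d = (a - d) - (c - b).
  by rewrite opprB [RHS]addrAC addrA.
have swap2 (a b c d : M) : a + b - c - d = (a - c) - (d - b).
  by rewrite opprB [RHS]addrACA addrA.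
by rewrite [LHS]swap !E1 // -swap [LHS]swap2 !E2 // -swap2.
Qed.

Lemma Mring_ind (P : M -> Prop) :
  (forall p q, p \is monic -> q \is monic -> P (cls p%:F - cls q%:F)) ->
  forall h, P h.
Proof.
move=> H h; rewrite (Mring_decomp h).
by have [mp mq _ _] := lowest_termsP h; apply: H.
Qed.

Lemma MmulC : commutative Mmul.
Proof.
elim/Mring_ind => p q mp mq; elim/Mring_ind => p' q' mp' mq'.
rewrite !MmulBB // (starC _ mp mp') (starC _ mq mq') (starC _ mp mq').
by rewrite (starC _ mq mp') addrAC.
Qed.

Lemma MmulBl p q h : p \is monic -> q \is monic ->
  let f r := cls (star iota r (Mnum h))%:F - cls (star iota r (Mden h))%:F in
  Mmul (cls p%:F - cls q%:F) h = f p - f q.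
Proof.
move=> mp mq f; have [mn md _ _] := lowest_termsP h.
rewrite [in LHS](Mring_decomp h) MmulBB // /f opprB.
by rewrite [RHS]addrACA addrA.
Qed.

Lemma MmulDl : left_distributive Mmul +%R.
Proof.
elim/Mring_ind => p q mp mq; elim/Mring_ind => r s mr ms h.
rewrite addrACA -opprD -!clsM; try exact: monic_ratioF.
have [mn md _ _] := lowest_termsP h.
rewrite -!rmorphM !MmulBl ?monicMl // !cls_starMl //.
by rewrite [RHS]addrACA -opprD; congr (_ - _); rewrite opprD addrACA.
Qed.

Lemma Mmul_cls p q : p \is monic -> q \is monic ->
  Mmul (cls p%:F) (cls q%:F) = cls (star iota p q)%:F.
Proof.
move=> mp mq; have m1 := monic1 K.
rewrite -[cls p%:F]subr0 -[cls q%:F]subr0 -cls1 -(tofrac1 {poly K}) MmulBB //.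
rewrite (starC _ mp m1) !star1l // rmorph1 cls1.
by rewrite addr0 !subr0.
Qed.

Lemma MmulN g h : Mmul (- g) h = - Mmul g h.
Proof.
have M0 : Mmul 0 h = 0 by apply: (addrI (Mmul 0 h)); rewrite -MmulDl !addr0.
by apply: (addrI (Mmul g h)); rewrite -MmulDl !subrr.
Qed.

Lemma Mmul_biadd_ext (P : M -> Prop) :
  (forall p, p \is monic -> P (cls p%:F)) ->
  (forall g h, P g -> P h -> P (g - h)) -> forall h, P h.
Proof. by move=> H1 H2; elim/Mring_ind => p q mp mq; apply: H2; apply: H1. Qed.

Lemma MmulBl' g h k : Mmul (g - h) k = Mmul g k - Mmul h k.
Proof. by rewrite MmulDl MmulN. Qed.
Lemma MmulBr' g h k : Mmul k (g - h) = Mmul k g - Mmul k h.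
Proof. by rewrite MmulC MmulBl' !(MmulC k). Qed.

Lemma MmulA : associative Mmul.
Proof.
elim/Mmul_biadd_ext => [p mp|g h IHg IHh]; last first.
  move=> x y; rewrite !(MmulBl' g h) (MmulBl' (Mmul g x) (Mmul h x)).
  by rewrite IHg IHh.
elim/Mmul_biadd_ext => [q mq|g h IHg IHh]; last first.
  move=> x; rewrite (MmulBl' g h x) (MmulBr' g h).
  rewrite (MmulBr' (Mmul g x) (Mmul h x)).
  by rewrite (MmulBl' (Mmul _ g) (Mmul _ h)) IHg IHh.
elim/Mmul_biadd_ext => [r mr|g h IHg IHh]; last first.
  by rewrite !(MmulBr' g h) (MmulBr' (Mmul _ g) (Mmul _ h)) IHg IHh.
by rewrite !Mmul_cls ?star_monic // starA.
Qed.

Definition Mone : M := cls ('X - 1)%:F.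

Lemma Mmul1 : left_id Mone Mmul.
Proof.
elim/Mmul_biadd_ext => [p mp|g h IHg IHh]; last by rewrite MmulBr' IHg IHh.
by rewrite /Mone Mmul_cls ?starX1l // -polyC1 monicXsubC.
Qed.

Lemma Mone_neq0 : Mone != 0.
Proof.
have m : ('X - 1 : {poly K}) \is monic by rewrite -polyC1 monicXsubC.
apply/eqP => /(congr1 (@ratfun K L iota)).
rewrite ratfun0 ratfun_cls; last exact: monic_ratioF.
move/eqP; rewrite -(tofrac1 {poly K}) tofrac_eq => /eqP/(congr1 (size \o val)).
by rewrite /= -polyC1 size_XsubC size_poly1.
Qed.

End MringMulTheory.

HB.instance Definition _ (K : fieldType) (L : closedFieldType)
    (iota : {rmorphism K -> L}) :=
  GRing.Zmodule_isComNzRing.Build (Mring iota) (@MmulA K L iota)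
    (@MmulC K L iota) (@Mmul1 K L iota) (@MmulDl K L iota) (@Mone_neq0 K L iota).

HB.lock Definition t_ {K : fieldType} {L : closedFieldType}
    (iota : {rmorphism K -> L}) (k : nat) (h : Mring iota) : K :=
  power_sum iota k (Mnum h) - power_sum iota k (Mden h).

Section PowerSums.
Context {K : fieldType} {L : closedFieldType} (iota : {rmorphism K -> L}).
Local Notation M := (Mring iota).

Local Notation t_ := (@t_ K L iota).

Lemma Mring_mulE p q : p \is monic -> q \is monic ->
  cls iota p%:F * cls iota q%:F = cls iota (star iota p q)%:F.
Proof. exact: Mmul_cls. Qed.

Lemma Mring_oneE : 1 = cls iota ('X - 1)%:F.
Proof. by []. Qed.


Lemma t_B_cls k p q : p \is monic -> q \is monic ->
  t_ k (cls iota p%:F - cls iota q%:F) =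
  power_sum iota k p - power_sum iota k q.
Proof. by rewrite t_.unlock; apply: Mring_ext => u v mu mv; apply: power_sumM. Qed.

Fact t_is_zmod_morphism k : zmod_morphism (t_ k).
Proof.
elim/(@Mring_ind K L iota) => p q mp mq.
elim/(@Mring_ind K L iota) => r s mr ms.
rewrite opprB addrACA -opprD -!clsM; try exact: monic_ratioF.
rewrite -!rmorphM /= !t_B_cls ?monicMl // !power_sumM //.
by rewrite opprB opprD addrACA.
Qed.

HB.instance Definition _ k :=
  GRing.isZmodMorphism.Build M K (t_ k) (t_is_zmod_morphism k).

Lemma t_cls k p : p \is monic -> t_ k (cls iota p%:F) = power_sum iota k p.
Proof.
move=> mp; have := t_B_cls k mp (monic1 K).
rewrite rmorph1 cls1 subr0 => ->.
suff -> : power_sum iota k 1 = 0 by rewrite subr0.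
apply: (addrI (power_sum iota k 1)).
by rewrite addr0 -power_sumM ?monic1 // mulr1.
Qed.

Fact t_is_monoid_morphism k : monoid_morphism (t_ k).
Proof.
have m1 : ('X - 1 : {poly K}) \is monic by rewrite -polyC1 monicXsubC.
split; first by rewrite Mring_oneE t_cls // power_sumX1.
elim/(@Mmul_biadd_ext K L iota) => [p mp|g h IHg IHh] y; last first.
  by rewrite mulrBl !raddfB /= IHg IHh mulrBl.
elim/(@Mmul_biadd_ext K L iota) : y => [q mq|g h IHg IHh]; last first.
  by rewrite mulrBr !raddfB /= IHg IHh mulrBr.
by rewrite Mring_mulE // !t_cls ?star_monic // power_sum_star.
Qed.

HB.instance Definition _ k :=
  GRing.isMonoidMorphism.Build M K (t_ k) (t_is_monoid_morphism k).

Definition t_family (h : M) : prod_topology (fun _ : nat => discrete_topology K) :=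
  fun k => t_ k h.

End PowerSums.

HB.instance Definition _ (K : fieldType) (L : closedFieldType)
    (iota : {rmorphism K -> L}) :=
  Topological.copy (Mring iota) (initial_topology (@t_family K L iota)).

Definition is_root {K : fieldType} {L : closedFieldType}
    (iota : {rmorphism K -> L}) (h : Mring iota) (z : L) : bool :=
  root (map_poly iota (Mnum h)) z || root (map_poly iota (Mden h)) z.

Definition algebraic_ext {F E : fieldType} (j : {rmorphism F -> E}) : Prop :=
  forall x : E, algebraicOver j x.

Definition finite_ext {F E : fieldType} (j : {rmorphism F -> E}) : Prop :=
  exists (n : nat) (b : 'I_n -> E),
    forall x : E, exists c : 'I_n -> F, x = \sum_(i < n) j (c i) * b i.

Definition aut_extends {K : fieldType} {L : closedFieldType}
    (iota : {rmorphism K -> L})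
    (sigma : {rmorphism K -> K}) (tau : {rmorphism L -> L}) : Prop :=
  bijective tau /\ forall x : K, tau (iota x) = iota (sigma x).

(* Main.v *)
(* A continuous phi is determined by the ring morphisms t_k o phi : M_K -> K.   *)
(* By continuity the kernel of t_k o phi contains the intersection of finitely *)
(* many ker t_i; being prime, it contains one of them, so that                 *)
(* t_k o phi = s_k o t_(n_k) with s_k an automorphism of K.                    *)
(* For a in K^* the element phi [x - a] is a unit with inverse phi [x - 1/a],  *)
(* so k |-> s_k(a)^(n_k) and its inverse are, for k > 0, integral combinations *)
(* of geometric sequences. Ordering the ratios modulo roots of unity shows     *)
(* that all these ratios are equal to a single f up to roots of unity. Hence   *)
(* s_k(a)^(n_k) / f^k is periodic in k > 0, and it is a unit among the         *)
(* algebraic integers. With a = 2 this gives n_k = n_1 k; for general a it     *)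
(* gives that s_k(a) / s_1(a) is a root of unity when n_1 > 0, and applying    *)
(* this to 1 + 4 a with a integral forces s_k = s_1. So the first alternative  *)
(* always holds, with s = 0 and exponent of x equal to 0.                      *)
Require Import Defs.
From HB Require Import structures.
From mathcomp Require Import all_boot all_order all_algebra.
From mathcomp Require Import all_classical.
From mathcomp Require Import topology_structure initial_topology.
From mathcomp Require Import discrete_topology function_spaces.
From mathcomp Require Import supremum_topology ring.
Import GRing.Theory.
Local Open Scope ring_scope.

Set Implicit Arguments.
Unset Strict Implicit.
Unset Printing Implicit Defensive.

(** * Roots of unity and orders modulo them *)

Section Torsion.
Variable L : fieldType.
Implicit Types (x y g : L) (P : L -> Prop).

(** An element of $\mathcal{M}_K$ is a signed multiset of roots, determined in characteristic 0 by
    its power sums ([power_sums_perm]). So it suffices to find one $m$ and one $\sigma$ with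
    $t_k\circ\phi=\sigma\circ t_{mk}$ for all $k$ ([t_phi_power]): then $\phi$ sends each root
    $\alpha$ to $\sigma(\alpha)^m$, which is alternative (1) with $s=0$.

    Continuity and the primality of kernels give $t_k\circ\phi=s_k\circ t_{n_k}$ ([hom_factor],
    [t_phi_factor]). The link between different $k$ comes from units. Since $[x-a]$ is invertible
    for $a\ne 0$, both $w_k=s_k(a)^{n_k}$ and $w_k^{-1}$ are, for $k>0$, integer combinations of
    finitely many geometric sequences. Modulo roots of unity the ratios lie in a torsion-free
    abelian group, which can be ordered; comparing extreme terms, as for units of a Laurent
    polynomial ring, leaves a single ratio $f$ ([geom_unit]). Hence $w_k/f^k$ is periodic and a unit
    among algebraic integers ([expsum_unit]).

    Taking $a=2$ turns integrality into inequalities between exponents, so $n_k=n_1k$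
    ([exponents_linear]). For general $a$ and $n_1>0$, the finiteness of the set of conjugates of
    $a$ makes $s_k(a)/s_1(a)$ a root of unity. A root of unity congruent to 1 modulo 4 is 1, whence
    $s_k=s_1$ ([automorphisms_constant]). *)

Definition torsion x := exists2 n, (0 < n)%N & x ^+ n = 1.

Lemma torsion_neq0 x : torsion x -> x != 0.
Proof.
case=> n n0 xn; apply/eqP => x0; move: xn; rewrite x0 expr0n.
by rewrite eqn0Ngt n0 => /eqP; rewrite eq_sym oner_eq0.
Qed.

Lemma torsion1 : torsion 1.
Proof. by exists 1%N. Qed.

Lemma torsionM x y : torsion x -> torsion y -> torsion (x * y).
Proof.
move=> [n n0 xn] [m m0 ym]; exists (n * m)%N; first by rewrite muln_gt0 n0.
by rewrite exprMn exprM xn expr1n mulnC exprM ym expr1n mulr1.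
Qed.

Lemma torsionV x : torsion x -> torsion x^-1.
Proof. by move=> [n n0 xn]; exists n; rewrite // exprVn xn invr1. Qed.

Lemma torsion_root n x : (0 < n)%N -> torsion (x ^+ n) -> torsion x.
Proof.
move=> n0 [m m0]; rewrite -exprM => xnm.
by exists (n * m)%N; rewrite ?muln_gt0 ?n0.
Qed.

Lemma torsion_common_exponent (l : seq L) :
  exists2 N, (0 < N)%N & forall x, x \in l -> torsion x -> x ^+ N = 1.
Proof.
elim: l => [|y l [N N0 IH]]; first by exists 1%N.
have [[n n0 yn]|ny] := pselect (torsion y).
  exists (n * N)%N; first by rewrite muln_gt0 n0.
  move=> x; rewrite inE => /orP[/eqP-> _|xl tx]; first by rewrite exprM yn expr1n.
  by rewrite mulnC exprM IH // expr1n.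
by exists N => // x; rewrite inE => /orP[/eqP->|/IH].
Qed.

(* The nonnegative cone of a (pre)order on the group of units whose           *)
(* equivalence classes are the cosets of the roots of unity.                  *)
Definition cone P :=
  [/\ forall x, P x -> x != 0, forall x, torsion x -> P x,
      forall x y, P x -> P y -> P (x * y)
    & forall x, P x -> P x^-1 -> torsion x].

Lemma coneX P x n : cone P -> P x -> P (x ^+ n).
Proof.
move=> [_ PT PM _] Px; elim: n => [|n IH]; last by rewrite exprS; apply: PM.
by rewrite expr0; apply/PT/torsion1.
Qed.

(** The new cone is $P\cdot g^{\mathbb{N}}$. If it contains an element and its inverse with total
    exponent $n+m>0$, then $g^{-(n+m)}\in P$; the last hypothesis gives $g\in P$, so nothing was
    added. *)
Lemma cone_adjoin P g : cone P -> g != 0 ->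
  (forall n, (0 < n)%N -> P (g ^- n) -> P g) ->
  exists P', [/\ cone P', P' g & forall x, P x -> P' x].
Proof.
move=> cP g0 Pg; have [P0 PT PM PV] := cP.
have P1 : P 1 by apply/PT/torsion1.
have sub x : P x -> exists p n, P p /\ x = p * g ^+ n.
  by exists x, 0%N; rewrite mulr1.
exists (fun x => exists p n, P p /\ x = p * g ^+ n); split=> //; last first.
  by exists 1, 1%N; rewrite mul1r.
split.
- by move=> _ [p [n [Pp ->]]]; rewrite mulf_neq0 ?expf_neq0 ?(P0 p).
- by move=> x /PT/sub.
- move=> _ _ [p [n [Pp ->]]] [q [m [Pq ->]]]; exists (p * q), (n + m)%N.
  by split; [exact: PM | rewrite exprD mulrACA].
- move=> x [p [n [Pp xE]]] [q [m [Pq yE]]].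
  have x0 : x != 0 by rewrite xE mulf_neq0 ?expf_neq0 ?(P0 p).
  have pq : p * q * g ^+ (n + m) = 1.
    by rewrite exprD mulrACA -xE -yE divff.
  have [/eqP|nm] := posnP (n + m).
    rewrite addn_eq0 => /andP[/eqP n0 /eqP m0].
    by apply: PV; rewrite ?yE ?xE ?n0 ?m0 mulr1.
  have {}Pg : P g.
    apply: (Pg _ nm); suff -> : g ^- (n + m) = p * q by apply: PM.
    by rewrite -[RHS]mulr1 -(divff (expf_neq0 (n + m) g0)) mulrA pq mul1r.
  by apply: PV; rewrite ?yE ?xE; apply: PM => //; apply: coneX.
Qed.

(** A finite substitute for ordering the torsion-free group of units modulo torsion. If $g$ cannot
    be adjoined, then $g^{-n}\in P$ for some $n>0$, and this allows $g^{-1}$ to be adjoined. *)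
Lemma cone_total (l : seq L) : (forall x, x \in l -> x != 0) ->
  exists2 P, cone P & forall x, x \in l -> P x \/ P x^-1.
Proof.
elim: l => [_|g l IH l0].
  exists (@torsion) => //; split=> //; first exact: torsion_neq0.
  exact: torsionM.
have [P cP Pl] : exists2 P, cone P & forall x, x \in l -> P x \/ P x^-1.
  by apply: IH => x xl; apply: l0; rewrite inE xl orbT.
have g0 : g != 0 by apply: l0; rewrite mem_head.
suff [P' [cP' P'g PP']] :
    exists P', [/\ cone P', P' g \/ P' g^-1 & forall x, P x -> P' x].
  exists P' => // x; rewrite inE => /orP[/eqP->//|/Pl[]/PP'] ?; by [left|right].
have [Pg|Pg] := pselect (forall n, (0 < n)%N -> P (g ^- n) -> P g).
  by have [P' [? ? ?]] := cone_adjoin cP g0 Pg; exists P'; split=> //; left.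
have [|m m0 Pm|P' [? ? ?]] := @cone_adjoin P g^-1 cP; first by rewrite invr_eq0.
  rewrite exprVn invrK in Pm.
  have [_ PT _ PV] := cP; apply/PT/torsionV.
  move/existsNP: Pg => [n /not_implyP[n0 /not_implyP[Pn _]]].
  have nm : (0 < n * m)%N by rewrite muln_gt0 n0.
  apply: (torsion_root nm); apply: PV.
    by rewrite mulnC exprM; apply: coneX.
  by rewrite exprM -exprVn; apply: coneX.
by exists P'; split=> //; right.
Qed.

Lemma cone_max P (l : seq L) : cone P -> l != [::] ->
  (forall x, x \in l -> x != 0) ->
  (forall x y, x \in l -> y \in l -> P (x / y) \/ P (x / y)^-1) ->
  exists2 g, g \in l & forall x, x \in l -> P (g / x).
Proof.
move=> [P0 PT PM PV]; elim: l => // y l IH _ l0 Pl.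
have y0 : y != 0 by apply: l0; rewrite mem_head.
have Pyy : P (y / y) by rewrite divff //; apply/PT/torsion1.
have [l_nil|l_neq0] := eqVneq l [::].
  by exists y => [|x]; rewrite l_nil inE // => /eqP->.
have [//|x xl|x z xl zl|g gl gmax] := IH.
- by apply: l0; rewrite inE xl orbT.
- by apply: Pl; rewrite inE ?xl ?zl orbT.
have g0 : g != 0 by apply: l0; rewrite inE gl orbT.
have [Pgy|] : P (g / y) \/ P (g / y)^-1.
- by apply: Pl; rewrite inE ?gl ?eqxx ?orbT.
- exists g; first by rewrite inE gl orbT.
  by move=> x; rewrite inE => /orP[/eqP->//|/gmax].
rewrite invf_div => Pyg; exists y; first by rewrite mem_head.
move=> x; rewrite inE => /orP[/eqP->//|/gmax Pgx].
by have := PM _ _ Pyg Pgx; rewrite mulrA divfK.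
Qed.

End Torsion.

(** * Independence of geometric sequences, and units among their combinations *)

Section GeometricSums.
Variable L : fieldType.

(** By linearity the relation extends from powers to all polynomials; a polynomial vanishing at
    every ratio except $x$ isolates the coefficient of $x$. *)
Lemma geom_indep (I : eqType) (r : seq I) (C b : I -> L) :
  (forall j, \sum_(i <- r) C i * b i ^+ j = 0) ->
  forall x, \sum_(i <- r | b i == x) C i = 0.
Proof.
move=> H x; pose p := \prod_(y <- map b r | y != x) ('X - y%:P).
have px : p.[x] != 0.
  rewrite horner_prod; elim/big_rec: _ => [|y z yx z0]; first exact: oner_neq0.
  by rewrite mulf_neq0 // hornerXsubC subr_eq0 eq_sym.
have Hp : \sum_(i <- r) C i * p.[b i] = 0.
  under eq_bigr => i _ do rewrite horner_coef mulr_sumr.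
  rewrite exchange_big /= big1 // => j _.
  under eq_bigr => i _ do rewrite mulrCA.
  by rewrite -mulr_sumr H mulr0.
apply: (mulIf px); rewrite mul0r mulr_suml -[RHS]Hp [LHS]big_mkcond /=.
rewrite [LHS]big_seq [RHS]big_seq; apply: eq_bigr => i ir.
case: eqP => [->//|/eqP bix]; suff -> : p.[b i] = 0 by rewrite mulr0.
apply/eqP; rewrite horner_prod prodf_seq_eq0; apply/hasP.
by exists (b i); rewrite ?map_f // bix hornerXsubC subrr eqxx.
Qed.

(** Brings a sum into the form that [geom_unit] requires: distinct ratios with nonzero
    coefficients. *)
Lemma geom_group (I : eqType) (r : seq I) (C b : I -> L) :
  let e x := \sum_(i <- r | b i == x) C i in
  forall phi : L -> L,
  \sum_(i <- r) C i * phi (b i) =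
  \sum_(x <- undup (map b r) | e x != 0) e x * phi x.
Proof.
move=> e phi; rewrite [RHS]big_mkcond /=.
transitivity (\sum_(x <- undup (map b r)) \sum_(i <- r | b i == x)
                C i * phi (b i)).
  rewrite (exchange_big_dep predT) //= big_seq [RHS]big_seq.
  apply: eq_bigr => i ir.
  under eq_bigl => x do rewrite eq_sym.
  by rewrite -big_filter filter_pred1_uniq ?undup_uniq ?mem_undup ?map_f ?big_seq1.
apply: eq_bigr => x _.
under eq_bigr => i /eqP-> do [].
by rewrite -mulr_suml -/(e x); case: eqP => // ->; rewrite mul0r.
Qed.

(* The two extreme elements of [G], for the order given by a cone, yield      *)
(* uniquely represented products, which have to be 1.                         *)
Lemma geom_unit (G H : seq L) (e f : L -> L) : uniq G -> uniq H ->
  (forall g, g \in G -> g != 0 /\ e g != 0) ->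
  (forall h, h \in H -> h != 0 /\ f h != 0) ->
  (forall g g', g \in G -> g' \in G -> torsion (g / g') -> g = g') ->
  (forall h h', h \in H -> h' \in H -> torsion (h / h') -> h = h') ->
  (forall j, (\sum_(g <- G) e g * g ^+ j) * (\sum_(h <- H) f h * h ^+ j) = 1) ->
  exists g, G = [:: g] /\ H = [:: g^-1].
Proof.
move=> uG uH G0 H0 tG tH GH.
have GH1 x : \sum_(z <- [seq (g, h) | g <- G, h <- H] | z.1 * z.2 == x)
    e z.1 * f z.2 = (x == 1)%:R.
  (* The index [None] carries the constant sequence 1 of the right-hand side, moved to the left with
     coefficient $-1$. *)
  pose r := None :: map some [seq (g, h) | g <- G, h <- H].
  pose C (o : option (L * L)) := if o is Some z then e z.1 * f z.2 else -1.
  pose b (o : option (L * L)) := if o is Some z then z.1 * z.2 else 1.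
  have /(_ x) : forall x, \sum_(o <- r | b o == x) C o = 0.
    apply: geom_indep => j; rewrite /r big_cons big_map /C /b /= expr1n mulr1.
    rewrite big_allpairs_dep /= addrC; apply/eqP; rewrite subr_eq0 -(GH j).
    apply/eqP; rewrite mulr_suml.
    apply: eq_bigr => g _; rewrite mulr_sumr; apply: eq_bigr => h _.
    by rewrite exprMn mulrACA.
  rewrite big_cons big_map /= eq_sym; case: eqP => _.
    by move/eqP; rewrite addrC subr_eq0 => /eqP->.
  by move->.
have neq0 : G != [::] /\ H != [::].
  split; apply/eqP => E; have := GH 0%N; rewrite E big_nil ?mul0r ?mulr0 => /eqP;
    by rewrite eq_sym oner_eq0.
pose rat (S : seq L) := [seq x / y | x <- S, y <- S].
have [|P cP Ptot] := @cone_total L (rat G ++ rat H).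
  move=> x; rewrite mem_cat => /orP[]/allpairsP[[u v] [/= uS vS ->]];
  rewrite mulf_neq0 ?invr_eq0 //.
  - by have [] := G0 _ uS.
  - by have [] := G0 _ vS.
  - by have [] := H0 _ uS.
  - by have [] := H0 _ vS.
have PG x y : x \in G -> y \in G -> P (x / y) \/ P (x / y)^-1.
  move=> xG yG; apply: Ptot; rewrite mem_cat; apply/orP; left.
  exact: allpairs_f.
have PH x y : x \in H -> y \in H -> P (x / y) \/ P (x / y)^-1.
  move=> xG yG; apply: Ptot; rewrite mem_cat; apply/orP; right.
  exact: allpairs_f.
(* The product of the two maxima has only one representation $gh$, so its coefficient $e(g)f(h)$ is
   nonzero; by [GH1] this product must be 1. *)
have extreme Q : cone Q ->
    (forall x y, x \in G -> y \in G -> Q (x / y) \/ Q (x / y)^-1) ->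
    (forall x y, x \in H -> y \in H -> Q (x / y) \/ Q (x / y)^-1) ->
    exists g h, [/\ g \in G, h \in H, g * h = 1,
      forall x, x \in G -> Q (g / x) & forall x, x \in H -> Q (h / x)].
  move=> cQ QG QH.
  have [g gG gm] := cone_max cQ (proj1 neq0) (fun x xG => proj1 (G0 x xG)) QG.
  have [h hH hm] := cone_max cQ (proj2 neq0) (fun x xG => proj1 (H0 x xG)) QH.
  exists g, h; split=> //; apply/eqP; apply: contraT => gh1.
  have := GH1 (g * h); rewrite (negPf gh1) => /eqP.
  have mem : (g, h) \in [seq (g, h) | g <- G, h <- H] by exact: allpairs_f.
  have ua : uniq [seq (g, h) | g <- G, h <- H].
    by apply: allpairs_uniq => // -[? ?] [? ?] _ _ [-> ->].
  rewrite big_mkcond (bigD1_seq _ mem ua) /= eqxx big_seq_cond big1 ?addr0.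
    by rewrite mulf_eq0 (negPf (proj2 (G0 _ gG))) (negPf (proj2 (H0 _ hH))).
  move=> [x y] /andP[/allpairsP[[x' y'] [/= xG yH [-> ->]]]] neq.
  case: eqP => // E; case/eqP: neq.
  have [x0 y0] : x' != 0 /\ y' != 0 by have [] := G0 _ xG; have [] := H0 _ yH.
  have h0 : h != 0 by have [] := H0 _ hH.
  have g0 : g != 0 by have [] := G0 _ gG.
  have E' : (g / x')^-1 = h / y'.
    by rewrite invf_div; apply/eqP; rewrite eqr_div // E mulrC.
  have [_ _ _ QV] := cQ.
  have /(tG _ _ gG xG) gx : torsion (g / x').
    by apply: QV; rewrite ?E'; [exact: gm | exact: hm].
  rewrite gx; congr (_, _); move: E; rewrite gx => /(mulfI x0)//.
have [g [h [gG hH gh gm hm]]] := extreme P cP PG PH.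
(* The opposite cone supplies the minima $g'$ and $h'$. *)
have cPV : cone (fun x => P x^-1).
  have [P0 PT PM PV] := cP; split=> [x /P0|x /torsionV/PT//|x y Px Py|x Px Py].
  - by rewrite invr_eq0.
  - by rewrite invfM; apply: PM.
  - by rewrite invrK in Py; apply: PV.
have [| |g' [h' [g'G h'H gh' gm' hm']]] := extreme _ cPV.
- by move=> x y xG yG; rewrite invrK; case: (PG x y xG yG); [right|left].
- by move=> x y xG yG; rewrite invrK; case: (PH x y xG yG); [right|left].
have [_ _ PM PV] := cP.
have neqG x : x \in G -> x != 0 by move/G0 => [].
have neqH x : x \in H -> x != 0 by move/H0 => [].
have inv x y : x * y = 1 -> x \in G -> y = x^-1.
  by move=> xy /neqG x0; apply: (mulfI x0); rewrite xy divff.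
have hE := inv _ _ gh gG; have h'E := inv _ _ gh' g'G.
(* Inversion reverses the order: $h=g^{-1}$ is maximal in [H], so $g'/g\in P$, while $g/g'\in P$ by
   maximality of $g$. *)
have gg' : g = g'.
  apply: tG => //; apply: PV; first exact: gm.
  by rewrite invf_div; have := hm _ h'H; rewrite hE h'E invrK mulrC.
have Gg x : x \in G -> x = g.
  move=> xG; symmetry; apply: tG => //; apply: PV; first exact: gm.
  by rewrite gg'; apply: gm'.
have Hh x : x \in H -> x = h.
  move=> xH; symmetry; apply: tH => //; apply: PV; first exact: hm.
  by have := hm' _ xH; rewrite h'E -gg' -hE.
have sing (S : seq L) y : uniq S -> y \in S -> (forall x, x \in S -> x = y) ->
    S = [:: y].
  case: S => [//|a [|b S]] /= uS yS Sy; first by rewrite (Sy a) ?mem_head.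
  move: uS; rewrite inE (Sy a) ?mem_head // (Sy b) ?eqxx //.
  by rewrite !inE eqxx orbT.
by exists g; rewrite -hE; split; apply: sing.
Qed.

End GeometricSums.

(** * Units among integral combinations of geometric sequences *)

Section UnitSums.
Variable L : fieldType.
Hypothesis char0 : [pchar L] =i pred0.

Local Notation integral := (integralOver (intr : int -> L)).

Lemma pchar0_intr_eq0 (z : int) : (z%:~R == 0 :> L) = (z == 0).
Proof.
have natE n : (n%:R == 0 :> L) = (n == 0)%N by move/pcharf0P: char0; apply.
by case: z => n; rewrite ?NegzE ?mulrNz ?oppr_eq0 -pmulrn natE.
Qed.

Lemma integral_torsion x : torsion x -> integral x.
Proof.
move=> [n n0 xn]; exists ('X^n - 1).
  by rewrite -(prednK n0) -polyC1 monicXnsubC.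
by rewrite /root rmorphB /= map_polyXn rmorph1 hornerD hornerXn xn hornerN
     hornerC subrr.
Qed.

Lemma integral_sum (I : eqType) (r : seq I) (P : pred I) (F : I -> L) :
  (forall i, i \in r -> P i -> integral (F i)) ->
  integral (\sum_(i <- r | P i) F i).
Proof.
move=> H; rewrite big_seq_cond; apply: (big_ind integral).
- exact: integral0.
- by move=> x y ? ?; apply: integral_add.
- by move=> i /andP[]; apply: H.
Qed.

Lemma sum_root_of_unity (N : nat) (x : L) : (0 < N)%N -> x ^+ N = 1 ->
  \sum_(k < N) x ^+ k.+1 = if x == 1 then N%:R else 0.
Proof.
move=> N0 xN; case: eqP => [->|/eqP x1].
  by rewrite (eq_bigr (fun=> 1)) ?sumr_const ?card_ord // => i; rewrite expr1n.
under eq_bigr do rewrite exprS.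
rewrite -mulr_sumr; suff -> : \sum_(i < N) x ^+ i = 0 by rewrite mulr0.
have x10 : x - 1 != 0 by rewrite subr_eq0.
by apply: (mulfI x10); rewrite -subrX1 xN subrr mulr0.
Qed.

Definition expsum (r : seq (int * L)) (k : nat) : L :=
  \sum_(i <- r) i.1%:~R * i.2 ^+ k.

Section Classes.
Variables (r s : seq (int * L)) (N : nat).
Hypotheses (r0 : forall i : int * L, i \in r -> i.2 != 0).
Hypotheses (s0 : forall i : int * L, i \in s -> i.2 != 0).
Hypothesis rs1 : forall k, (0 < k)%N -> expsum r k * expsum s k = 1.
Hypothesis N0 : (0 < N)%N.
Hypothesis rN : forall i j : int * L, i \in r -> j \in r ->
  torsion (i.2 / j.2) -> (i.2 / j.2) ^+ N = 1.
Hypothesis sN : forall i j : int * L, i \in s -> j \in s ->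
  torsion (i.2 / j.2) -> (i.2 / j.2) ^+ N = 1.

(** Ratios are classified by their [N]-th power: for ratios in [r], or in [s], two have equal [N]-th
    powers exactly when they differ by a root of unity. *)
Definition class_sum (t : seq (int * L)) (k : nat) (x : L) : L :=
  \sum_(i <- t | i.2 ^+ N == x) i.1%:~R * i.2 ^+ k.

Let supp t k : seq L :=
  [seq x <- undup (map (fun i => i.2 ^+ N) t) | class_sum t k x != 0].

Let supp_neq0 (t : seq (int * L)) k x : (forall i : int * L, i \in t -> i.2 != 0) -> x \in supp t k ->
  x != 0 /\ class_sum t k x != 0.
Proof.
move=> t0; rewrite mem_filter mem_undup => /andP[c0 /mapP[i it xE]].
by split=> //; rewrite xE expf_neq0 ?t0.
Qed.

Let supp_out t k x : x \notin supp t k -> class_sum t k x = 0.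
Proof.
rewrite mem_filter mem_undup negb_and negbK => /orP[/eqP//|xt].
rewrite /class_sum big_seq_cond big_pred0 // => i.
by apply/negP => /andP[it /eqP E]; case/negP: xt; apply/mapP; exists i.
Qed.

Let supp_sum t k j :
  \sum_(x <- supp t k) class_sum t k x * x ^+ j = expsum t (k + N * j)%N.
Proof.
rewrite big_filter -(geom_group t (fun i => i.1%:~R * i.2 ^+ k)
  (fun i => i.2 ^+ N) (fun x => x ^+ j)).
by apply: eq_bigr => i _; rewrite -exprM -mulrA -exprD.
Qed.

Let supp_torsion (t : seq (int * L)) k x y : (forall i : int * L, i \in t -> i.2 != 0) ->
  (forall i j : int * L, i \in t -> j \in t ->
     torsion (i.2 / j.2) -> (i.2 / j.2) ^+ N = 1) ->
  x \in supp t k -> y \in supp t k -> torsion (x / y) -> x = y.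
Proof.
move=> t0 tN; rewrite !mem_filter !mem_undup.
move=> /andP[_ /mapP[i it ->]] /andP[_ /mapP[j jt ->]].
rewrite -expr_div_n => /torsion_root -/(_ N0) /(tN _ _ it jt).
by rewrite expr_div_n => /divr1_eq.
Qed.

(** Along the progression $k+Nj$ both sums become geometric sums in $j$ whose ratios are the
    classes, pairwise distinct modulo torsion, so [geom_unit] applies. The surviving class may still
    depend on $k$. *)
Lemma class_sum_single k : (0 < k)%N -> exists g, [/\
  g \in map (fun i => i.2 ^+ N) r,
  forall x, class_sum r k x = if x == g then expsum r k else 0 &
  forall x, class_sum s k x = if x == g^-1 then expsum s k else 0].
Proof.
move=> k0; have [||||||j|g [rE sE]] := @geom_unit L (supp r k) (supp s k)
  (class_sum r k) (class_sum s k).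
- by rewrite filter_uniq ?undup_uniq.
- by rewrite filter_uniq ?undup_uniq.
- by move=> g; apply: supp_neq0.
- by move=> g; apply: supp_neq0.
- by move=> x y; apply: supp_torsion.
- by move=> x y; apply: supp_torsion.
- by rewrite !supp_sum rs1 // ltn_addr.
exists g; split.
- have : g \in supp r k by rewrite rE mem_head.
  by rewrite mem_filter mem_undup => /andP[].
- move=> x; case: eqP => [->|xg].
    by have := supp_sum r k 0; rewrite rE big_seq1 mulr1 muln0 addn0.
  by apply: supp_out; rewrite rE inE; apply/eqP.
- move=> x; case: eqP => [->|xg].
    by have := supp_sum s k 0; rewrite sE big_seq1 mulr1 muln0 addn0.
  by apply: supp_out; rewrite sE inE; apply/eqP.
Qed.

(* The product of the two class sums is a 0-1-valued function of k mod N; its *)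
(* mean is the coefficient at the root of unity 1, hence an integer, so the   *)
(* function is constant.                                                      *)
Lemma class_sum_constant : exists f, [/\ f != 0,
  forall k, (0 < k)%N -> class_sum r k (f ^+ N) = expsum r k &
  forall k, (0 < k)%N -> class_sum s k (f ^- N) = expsum s k].
Proof.
have [_ [/mapP[i0 i0r ->]]] := @class_sum_single 1 isT.
set f := i0.2 => rf sf; have f0 : f != 0 by apply: r0.
pose U k := class_sum r k (f ^+ N) * class_sum s k (f ^- N).
have U1 : U 1%N = 1 by rewrite /U rf sf !eqxx rs1.
have U01 k : (0 < k)%N -> U k = (U k == 1)%:R.
  move=> k0; rewrite /U; have [g [_ -> ->]] := class_sum_single k0.
  rewrite (can_eq (@invrK L)); case: eqP => _; first by rewrite rs1 // eqxx.
  by rewrite mulr0 eq_sym oner_eq0.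
have UE k : U k = \sum_(i <- r | i.2 ^+ N == f ^+ N)
    \sum_(j <- s | j.2 ^+ N == f ^- N) (i.1 * j.1)%:~R * (i.2 * j.2) ^+ k.
  rewrite /U /class_sum mulr_suml; apply: eq_bigr => i _.
  rewrite mulr_sumr; apply: eq_bigr => j _.
  by rewrite intrM exprMn mulrACA.
have UN k : U (k + N)%N = U k.
  rewrite !UE; apply: eq_bigr => i /eqP iN; apply: eq_bigr => j /eqP jN.
  by rewrite exprD [X in _ * (_ * X)]exprMn iN jN divff ?mulr1 // expf_neq0.
have [z zE] : exists z : int, \sum_(k < N) U k.+1 = N%:R * z%:~R.
  exists (\sum_(i <- r | i.2 ^+ N == f ^+ N)
    \sum_(j <- s | j.2 ^+ N == f ^- N) (i.1 * j.1) * (i.2 * j.2 == 1)).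
  under eq_bigr => k _ do rewrite UE.
  rewrite exchange_big /= rmorph_sum mulr_sumr /=.
  apply: eq_bigr => i /eqP iN; rewrite exchange_big /= rmorph_sum mulr_sumr /=.
  apply: eq_bigr => j /eqP jN; rewrite -mulr_sumr sum_root_of_unity //.
    by rewrite [in RHS]intrM mulrCA; case: eqP => _; rewrite ?mulr1 ?mulr0.
  by rewrite exprMn iN jN divff // expf_neq0.
have UT k : (k < N)%N -> U k.+1 = 1.
  (* The number of indices in one period at which the class of [f] survives. It equals $Nz$ and is
     positive because of $k=1$, so it is at least [N]. *)
  pose n := (\sum_(k < N) (U k.+1 == 1%R))%N.
  have nz : n%:Z = N%:Z * z.
    apply/eqP; rewrite -subr_eq0 -pchar0_intr_eq0 rmorphB rmorphM /= subr_eq0.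
    rewrite -!pmulrn -zE /n natr_sum; apply/eqP/eq_bigr => i _.
    by rewrite [RHS]U01.
  have n0 : (0 < n)%N by rewrite /n (bigD1 (Ordinal N0)) //= U1 eqxx.
  have nN : (N <= n)%N.
    have : (N %| n)%N by move: nz; case: z {zE} => z nz;
      [apply/dvdnP; exists z; rewrite mulnC; case: nz
      |move: nz; case: N N0 => // N' _ ; rewrite NegzE mulrN; case: n n0].
    exact: dvdn_leq.
  move=> kN; apply/eqP; move: nN; apply: contraTT => Uk; rewrite -ltnNge.
  rewrite /n (bigD1 (Ordinal kN)) //= (negPf Uk) add0n.
  apply: (@leq_ltn_trans (\sum_(i < N | i != Ordinal kN) 1)).
    by apply: leq_sum => i _; case: (_ == _).
  by rewrite sum1_card cardC1 card_ord prednK.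
have UT' k : (0 < k)%N -> U k = 1.
  case: k => // k _; rewrite (divn_eq k N) -addnS addnC.
  elim: (k %/ N)%N => [|q IH]; first by rewrite addn0 UT // ltn_mod.
  by rewrite mulSn addnCA addnC UN.
exists f; split=> // k k0; have := UT' k k0; rewrite /U;
  have [g [_ -> ->]] := class_sum_single k0; rewrite (can_eq (@invrK L));
  case: eqP => // _; rewrite mulr0 => /eqP; by rewrite eq_sym oner_eq0.
Qed.
End Classes.

(** Only the ratios $f\zeta$ with $\zeta^N=1$ contribute to the first sum, and $f^{-1}\zeta$ to the
    second; after removal of $f^{\pm k}$ there remain integer combinations of roots of unity. *)
Lemma expsum_unit (r s : seq (int * L)) :
  (forall i : int * L, i \in r -> i.2 != 0) -> (forall i : int * L, i \in s -> i.2 != 0) ->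
  (forall k, (0 < k)%N -> expsum r k * expsum s k = 1) ->
  exists f N, [/\ f != 0, (0 < N)%N,
    forall k, (0 < k)%N -> expsum r (k + N) = expsum r k * f ^+ N,
    forall k, (0 < k)%N -> integral (expsum r k / f ^+ k) &
    forall k, (0 < k)%N -> integral (expsum s k * f ^+ k)].
Proof.
move=> r0 s0 rs1.
pose rat (t : seq (int * L)) := [seq i.2 / j.2 | i <- t, j <- t].
have [N N0 HN] := torsion_common_exponent (rat r ++ rat s).
have [||f [f0 fr fs]] := @class_sum_constant r s N r0 s0 rs1 N0.
- move=> i j ir jr; apply: HN; rewrite mem_cat; apply/orP; left.
  by apply: (allpairs_f (fun i j : int * L => i.2 / j.2)).
- move=> i j ir jr; apply: HN; rewrite mem_cat; apply/orP; right.
  by apply: (allpairs_f (fun i j : int * L => i.2 / j.2)).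
have intk (m : int) (x : L) (k : nat) : x ^+ N = 1 -> integral (m%:~R * x ^+ k).
  move=> xN; apply: integral_mul; first exact: integral_id.
  apply: integral_torsion; exists N => //.
  by rewrite -exprM mulnC exprM xN expr1n.
exists f, N; split=> // k k0.
- rewrite -!fr ?addn_gt0 ?k0 // /class_sum mulr_suml; apply: eq_bigr => i /eqP iN.
  by rewrite exprD mulrA iN.
- rewrite -fr // /class_sum mulr_suml; apply: integral_sum => i _ /eqP iN.
  rewrite -mulrA -expr_div_n; apply: intk.
  by rewrite expr_div_n iN divff // expf_neq0.
- rewrite -fs // /class_sum mulr_suml; apply: integral_sum => i _ /eqP iN.
  rewrite -mulrA -exprMn; apply: intk.
  by rewrite exprMn iN mulVf // expf_neq0.
Qed.

End UnitSums.

(** * Algebraic integers *)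

Section Integrality.
Variable L : fieldType.
Hypothesis char0 : [pchar L] =i pred0.

Local Notation integral := (integralOver (intr : int -> L)).

Lemma pchar0_natr_neq0 n : (0 < n)%N -> n%:R != 0 :> L.
Proof. by move/pcharf0P: char0 => ->; rewrite -lt0n. Qed.

(** Clearing denominators in a monic integral equation for $1/2$ would make an odd integer $2z+1$
    vanish. *)
Lemma half_not_integral : ~ integral 2^-1.
Proof.
have two0 : 2 != 0 :> L by apply: (pchar0_natr_neq0 (n := 2)).
move=> [p mp /rootP]; set q := map_poly _ p => qr.
have sq : size q = size p.
  by apply: size_map_poly_id0; rewrite (monicP mp) oner_neq0.
have sp : size p = (size p).-1.+1 by rewrite prednK // size_poly_gt0 monic_neq0.
set n := (size p).-1 in sp; pose z := \sum_(i < n) p`_i * 2 ^+ (n - i).-1.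
have : (2 * z + 1)%:~R = 0 :> L.
  rewrite -(mulr0 (2 ^+ n)) -qr horner_coef sq sp big_ord_recr /=.
  rewrite !coef_map /= -[p`_n]/(lead_coef p) (monicP mp) mul1r mulrDr.
  rewrite -exprMn divff // expr1n rmorphD rmorph1; congr (_ + _).
  rewrite rmorphM rmorph_sum !mulr_sumr; apply: eq_bigr => i _.
  rewrite !coef_map rmorphM /= rmorphXn /=.
  have -> : 2 ^+ n = 2 ^+ (n - i).-1.+1 * 2 ^+ i :> L.
    by rewrite prednK ?subn_gt0 // -exprD subnK // ltnW.
  rewrite exprS exprVn mulrACA divff ?expf_neq0 // mulr1 -mulrA.
  by rewrite [_ ^+ _ * _]mulrC.
move/eqP; rewrite (pchar0_intr_eq0 char0) addr_eq0 => /eqP z0.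
by have := dvdz_mulr z (dvdzz 2); rewrite z0.
Qed.

Lemma integral_pow2_leq x y : integral (2 ^+ x / 2 ^+ y) -> (y <= x)%N.
Proof.
have two0 : 2 != 0 :> L by apply: (pchar0_natr_neq0 (n := 2)).
move=> I; rewrite leqNgt; apply/negP => xy; apply: half_not_integral.
have -> : 2^-1 = 2%:R ^+ (y - x.+1) * (2 ^+ x / 2 ^+ y) :> L.
  rewrite -{2}(subnK xy) [X in _ = _ * (_ / X)]exprD [2 ^+ x.+1]exprS.
  by field; rewrite two0 !expf_neq0.
apply: integral_mul => //; rewrite -natrX; exact: integral_nat.
Qed.

(* The order [n] of [z] is divisible by 4 up to integral elements, since      *)
(* [\sum_(k < n) z ^+ k = 0]; hence [n] is even and [-1] is a power of [z].   *)
Lemma torsion_congr1 (z : L) : torsion z -> integral ((z - 1) / 4) -> z = 1.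
Proof.
have two0 : 2 != 0 :> L by apply: (pchar0_natr_neq0 (n := 2)).
have four0 : 4 != 0 :> L by apply: (pchar0_natr_neq0 (n := 4)).
have fourE : 4 = 2 * 2 :> L by rewrite -natrM.
move=> tz I4; apply/eqP; apply: contraT => z1; case: half_not_integral.
have exz : exists n, (0 < n)%N && (z ^+ n == 1).
  by case: tz => n n0 /eqP zn; exists n; rewrite n0.
case: (ex_minnP exz) => n /andP[n0 /eqP zn] nmin.
have Iz k : integral ((z ^+ k - 1) / 4).
  rewrite subrX1 mulrAC; apply: integral_mul => //.
  apply: integral_sum => i _ _; apply: integral_torsion.
  by have [m m0 zm] := tz; exists m => //; rewrite -exprM mulnC exprM zm expr1n.
have In : integral (n%:R / 4).
  have -> : n%:R / 4 = - \sum_(k < n) (z ^+ k - 1) / 4.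
    rewrite -mulr_suml sumrB sumr_const card_ord.
    have -> : \sum_(k < n) z ^+ k = 0.
      have z10 : z - 1 != 0 by rewrite subr_eq0.
      by apply: (mulfI z10); rewrite -subrX1 zn subrr mulr0.
    by rewrite sub0r mulNr opprK.
  by apply: integral_opp; apply: integral_sum.
have [on|en] := boolP (odd n).
  have -> : 2^-1 = 2 * (n%:R / 4) - n./2%:R :> L.
    have -> : n%:R = 1 + n./2%:R * 2 :> L.
      by rewrite -natrM -mulrS muln2 -{1}[n]odd_double_half on.
    by field; rewrite four0 two0.
  apply: integral_sub; last exact: integral_nat.
  by apply: integral_mul => //; apply: (integral_nat _ 2).
have nE : n = (n./2 * 2)%N by rewrite -{1}(odd_double_half n) (negPf en) muln2.
have zh : z ^+ n./2 = -1.
  have : (z ^+ n./2 - 1) * (z ^+ n./2 + 1) = 0.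
    by rewrite -subr_sqr -exprM -nE zn expr1n subrr.
  move/eqP; rewrite mulf_eq0 subr_eq0 addr_eq0 => /orP[zh1|/eqP//].
  have h0 : (0 < n./2)%N by move: n0; rewrite {1}nE muln_gt0 => /andP[].
  have := ltn_Pmulr (ltnSn 1) h0.
  by rewrite -nE ltnNge (nmin _ (introT andP (conj h0 zh1))).
have := integral_opp (Iz n./2); rewrite zh -opprD mulNr opprK fourE invfM.
by rewrite mulrA -[1 + 1]/2 divff // mul1r.
Qed.

(** The value $v_i^i$ is constant along $i=k+Nj$, and two indices of this progression share the same
    $v_i=w$. Comparing exponents shows that $w$ is torsion, and $v_k^k$ is a power of $w$. *)
Lemma pigeonhole_torsion (l : seq L) (v : nat -> L) (N : nat) : (0 < N)%N ->
  (forall k, (0 < k)%N -> v k \in l) -> (forall k, (0 < k)%N -> v k != 0) ->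
  (forall k, (0 < k)%N -> v (k + N)%N ^+ (k + N) = v k ^+ k) ->
  forall k, (0 < k)%N -> torsion (v k).
Proof.
move=> N0 vl v0 vN k k0.
have vk j : v (k + N * j)%N ^+ (k + N * j) = v k ^+ k.
  elim: j => [|j <-]; first by rewrite muln0 addn0.
  by rewrite mulnS [(N + _)%N]addnC addnA vN // addn_gt0 k0.
pose s := mkseq (fun j => v (k + N * j)%N) (size l).+1.
have /(uniqPn 0) [i [j [ij]]] : ~~ uniq s.
  apply/negP => us; have : (size s <= size l)%N.
    apply: uniq_leq_size => // _ /mapP[j _ ->].
    by apply: vl; rewrite addn_gt0 k0.
  by rewrite size_mkseq ltnn.
rewrite size_mkseq => jl; rewrite !nth_mkseq //; last exact: ltn_trans jl.
move=> vij; set w := v (k + N * i)%N in vij.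
have w0 : w != 0 by apply: v0; rewrite addn_gt0 k0.
have tw : torsion w.
  exists (N * (j - i))%N; first by rewrite muln_gt0 N0 subn_gt0.
  have := vk j; rewrite -vij -(vk i) -/w.
  rewrite -{1}(subnK (ltnW ij)) mulnDr addnCA exprD => E.
  by apply: (mulIf (expf_neq0 (k + N * i) w0)); rewrite E mul1r.
apply: (torsion_root k0); rewrite -(vk i) -/w.
by case: tw => n n0 wn; exists n => //; rewrite -exprM mulnC exprM wn expr1n.
Qed.

End Integrality.

Lemma integral_multiple (K : fieldType) (j : {rmorphism rat -> K}) (x : K) :
  algebraicOver j x -> [pchar K] =i pred0 ->
  exists2 d : int, d != 0 & integralOver (intr : int -> K) (d%:~R * x).
Proof.
move=> [p p0 /rootP px] char0.
have [q [a a0 pE]] := rat_poly_scale p.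
have q0 : q != 0.
  by apply: contraNneq p0 => q0; rewrite pE q0 rmorph0 scaler0.
have qx : (map_poly intr q : {poly K}).[x] = 0.
  have jE : map_poly j (map_poly intr q) = map_poly intr q.
    by rewrite -map_poly_comp; apply: eq_map_poly => i /=; rewrite rmorph_int.
  have /eqP := px; rewrite pE map_polyZ /= jE hornerZ mulf_eq0 => /orP[|/eqP//].
  by rewrite fmorphV invr_eq0 rmorph_int (pchar0_intr_eq0 char0) (negPf a0).
set d := lead_coef q; set n := (size q).-1.
have d0 : d != 0 by rewrite lead_coef_eq0.
exists d => //.
have sqK : size (map_poly intr q : {poly K}) = size q.
  by apply: size_map_poly_id0; rewrite (pchar0_intr_eq0 char0).
have sq : size q = n.+1 by rewrite prednK // size_poly_gt0.
have n0 : (0 < n)%N.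
  rewrite lt0n; apply/negP => /eqP n0.
  move: qx; rewrite horner_coef sqK sq n0 big_ord1 mulr1 coef_map /=.
  move/eqP; rewrite (pchar0_intr_eq0 char0) => /eqP qz.
  by case/eqP: d0; rewrite /d lead_coefE -/n n0.
(* This is $d^{n-1}q(X/d)$, monic with integer coefficients and vanishing at $dx$. *)
exists ('X^n + \poly_(i < n) (q`_i * d ^+ (n.-1 - i))).
  by rewrite monicE lead_coefDl ?lead_coefXn // size_polyXn ltnS size_poly.
apply/rootP; rewrite rmorphD /= map_polyXn hornerD hornerXn.
have -> : map_poly intr (\poly_(i < n) (q`_i * d ^+ (n.-1 - i))) =
    \poly_(i < n) (q`_i * d ^+ (n.-1 - i))%:~R :> {poly K}.
  apply/polyP => i; rewrite coef_map !coef_poly /=.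
  by case: ifP => _ //; rewrite rmorph0.
rewrite horner_poly -[RHS](mulr0 (d%:~R ^+ n.-1)) -[in RHS]qx [in RHS]horner_coef sqK sq.
rewrite big_ord_recr /= [LHS]addrC mulrDr; congr (_ + _).
  rewrite mulr_sumr; apply: eq_bigr => i _; rewrite coef_map rmorphM rmorphXn /=.
  have -> : d%:~R ^+ n.-1 = d%:~R ^+ (n.-1 - i) * d%:~R ^+ i :> K.
    by rewrite -exprD subnK // -ltnS prednK.
  by rewrite exprMn; ring.
by rewrite coef_map /= -[q`_n]/d mulrA -exprSr prednK // exprMn.
Qed.

(** It suffices to treat integral $x$. The hypothesis at $1+4x$ yields a root of unity
    $z=f(1+4x)/g(1+4x)$ that is congruent to 1 modulo 4, so $z=1$ by [torsion_congr1]. *)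
Lemma rmorph_eq_torsion (K L : fieldType) (j : {rmorphism rat -> K})
    (f g : {rmorphism K -> L}) : algebraic_ext j -> [pchar K] =i pred0 ->
  (forall x, x != 0 -> torsion (f x / g x)) -> f =1 g.
Proof.
move=> algK charK fg x; have charL : [pchar L] =i pred0.
  by move=> p; rewrite (fmorph_pchar f).
have [d d0 Idx] := integral_multiple (algK x) charK.
have four0 : 4 != 0 :> L by apply: (pchar0_natr_neq0 charL (n := 4)).
suff E : f (d%:~R * x) = g (d%:~R * x).
  have dL : d%:~R != 0 :> L by rewrite (pchar0_intr_eq0 charL).
  by apply: (mulfI dL); move: E; rewrite !rmorphM !rmorph_int.
move: {d d0 x}(d%:~R * x) Idx => x Ix.
have rI (h : {rmorphism K -> L}) : integralOver (intr : int -> L) (h x).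
  have [p mp px] := Ix; exists p => //.
  have -> : map_poly intr p = map_poly h (map_poly intr p).
    by rewrite -map_poly_comp; apply: eq_map_poly => i /=; rewrite rmorph_int.
  by rewrite fmorph_root.
suff E : f (1 + 4 * x) = g (1 + 4 * x).
  apply: (mulfI four0); apply: (addrI 1).
  by move: E; rewrite !rmorphD !rmorphM !rmorph1 !rmorph_nat.
have [->|x0] := eqVneq (1 + 4 * x) 0; first by rewrite !rmorph0.
have t := fg _ x0; have g0 : g (1 + 4 * x) != 0 by rewrite fmorph_eq0.
apply: divr1_eq; apply: (torsion_congr1 charL) => //.
set z := f _ / _ in t *.
have -> : (z - 1) / 4 = f x - g x - (z - 1) * g x.
  rewrite /z; move: g0; rewrite !rmorphD !rmorphM !rmorph1 !rmorph_nat => g0.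
  by field; rewrite four0 g0.
have Iz := integral_torsion t.
apply: integral_sub; first exact: integral_sub.
by apply: integral_mul => //; apply: integral_sub => //; apply: integral1.
Qed.

(** * Extension of field morphisms to an algebraic closure *)

Section Extension.
Variables (K : fieldType) (L M : closedFieldType).
Variables (i : {rmorphism K -> L}) (s : {rmorphism K -> M}).
Hypothesis i_alg : algebraic_ext i.

(* Graph of a ring morphism from a subring of L to M extending s.             *)
Definition partial_extension (S : set (L * M)) : Prop :=
  [/\ forall x, S (i x, s x), forall u v, S u -> S v -> S (u - v),
      forall u v, S u -> S v -> S (u * v) & forall y, S (0, y) -> y = 0].

Section OneStep.
Variable S : set (L * M).
Hypothesis S_ext : partial_extension S.

Let SK x : S (i x, s x). Proof. by case: S_ext. Qed.
Let SB u v : S u -> S v -> S (u - v). Proof. by case: S_ext => _ + _ _; apply. Qed.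
Let SM u v : S u -> S v -> S (u * v). Proof. by case: S_ext => _ _ + _; apply. Qed.
Let S_fun y : S (0, y) -> y = 0. Proof. by case: S_ext => _ _ _; apply. Qed.
Let S0 : S 0. Proof. by have := SK 0; rewrite !rmorph0. Qed.
Let S1 : S 1. Proof. by have := SK 1; rewrite !rmorph1. Qed.
Let SD u v : S u -> S v -> S (u + v).
Proof.
by move=> Su Sv; rewrite -[v]opprK; apply: SB => //; rewrite -sub0r; apply: SB.
Qed.
Let Ssum n (F : 'I_n -> L * M) : (forall k, S (F k)) -> S (\sum_k F k).
Proof. by move=> SF; apply: (big_ind S). Qed.

Definition coefs_in (R : {poly L * M}) := forall k, S R`_k.

Let horner_in R z : coefs_in R -> S z -> S R.[z].
Proof.
move=> SR Sz; rewrite horner_coef; apply: Ssum => k; apply: SM => //.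
by elim: (k : nat) => [|n IH]; rewrite ?expr0 // exprS; apply: SM.
Qed.

Let fstM (u v : L * M) : (u * v).1 = u.1 * v.1. Proof. by []. Qed.
Let sndM (u v : L * M) : (u * v).2 = u.2 * v.2. Proof. by []. Qed.
Let fstX (u : L * M) n : (u ^+ n).1 = u.1 ^+ n. Proof. exact: rmorphXn. Qed.
Let sndX (u : L * M) n : (u ^+ n).2 = u.2 ^+ n. Proof. exact: rmorphXn. Qed.
Let fst_sum n (F : 'I_n -> L * M) : (\sum_k F k).1 = \sum_k (F k).1.
Proof. exact: raddf_sum. Qed.
Let snd_sum n (F : 'I_n -> L * M) : (\sum_k F k).2 = \sum_k (F k).2.
Proof. exact: raddf_sum. Qed.

(** A nonzero $x$ is a root of some $q$ over [K] with $q_0\ne 0$. Evaluating the pair of images of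
    $q$ at $(x,0)$ puts $(0,s(q_0))$ in [S], which forces $q_0=0$. *)
Let S_inj x : S (x, 0) -> x = 0.
Proof.
move=> Sx; apply/eqP; apply: contraT => x0.
have [p p0 px] := i_alg x.
have [n [q]] := multiplicity_XsubC p 0; rewrite p0 /= => q0 pE.
have qx : (map_poly i q).[x] = 0.
  move: px; rewrite pE subr0 rmorphM rmorphXn /= map_polyX rootM => /orP[/rootP//|].
  by rewrite /root hornerXn expf_eq0 (negPf x0) andbF.
case/negP: q0; apply/rootP; rewrite horner_coef0.
apply: (fmorph_inj s); rewrite rmorph0; apply: S_fun.
have : S (\poly_(k < size q) (i q`_k, s q`_k)).[(x, 0)].
  apply: horner_in => // k; rewrite coef_poly; case: ifP => // _; exact: SK.
rewrite horner_poly => H; suff <- : \sum_(k < size q)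
   (i q`_k, s q`_k) * (x, 0) ^+ k = (0, s q`_0) by [].
rewrite [LHS]surjective_pairing; congr (_, _).
  rewrite fst_sum -[RHS]qx horner_coef size_map_poly.
  by apply: eq_bigr => k _; rewrite fstM fstX coef_map.
rewrite snd_sum; case sq: (size q) => [|m].
  by rewrite big_ord0 nth_default ?sq // rmorph0.
rewrite big_ord_recl sndM sndX mulr1 big1 ?addr0 // => k _.
by rewrite sndM sndX /= expr0n mulr0.
Qed.

Let coefs_inB R R' : coefs_in R -> coefs_in R' -> coefs_in (R - R').
Proof. by move=> SR SR' k; rewrite coefB; apply: SB. Qed.

Let coefs_inM R R' : coefs_in R -> coefs_in R' -> coefs_in (R * R').
Proof. by move=> SR SR' k; rewrite coefM; apply: Ssum => l; apply: SM. Qed.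

Let coefs_inC z : S z -> coefs_in z%:P.
Proof. by move=> Sz k; rewrite coefC; case: ifP. Qed.

Let coefs_inXn n : coefs_in 'X^n.
Proof. by move=> k; rewrite coefXn; case: (_ == _). Qed.

(** The analogue of a minimal polynomial of [a] is an annihilator [Q] of least size with
    coefficients in [S]; [b] is any root of its second projection, and [S'] is the subring generated
    by [S] and $(a,b)$. *)
Lemma partial_extension_step (a : L) : exists b S',
  [/\ partial_extension S', forall u, S u -> S' u & S' (a, b)].
Proof.
have fstE (R : {poly L * M}) z : R.[z].1 = (map_poly fst R).[z.1].
  by rewrite horner_map.
have sndE (R : {poly L * M}) z : R.[z].2 = (map_poly snd R).[z.2].
  by rewrite horner_map.
have S_eq0 u : S u -> u != 0 -> u.1 != 0 /\ u.2 != 0.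
  case: u => x y Su u0; split; apply: contraNneq u0 => /= E.
  - by rewrite E in Su *; rewrite (S_fun Su).
  - by rewrite E in Su *; rewrite (S_inj Su).
pose ann n := `[< exists R, [/\ coefs_in R, R != 0, (map_poly fst R).[a] = 0
                            & size R = n] >].
have exann : exists n, ann n.
  have [p p0 /rootP px] := i_alg a.
  pose R : {poly L * M} := \poly_(k < size p) (i p`_k, s p`_k).
  have Rp : map_poly fst R = map_poly i p.
    apply/polyP => k; rewrite !coef_map coef_poly; case: ltnP => //= pk.
    by rewrite nth_default // rmorph0.
  exists (size R); apply/asboolP; exists R; split=> //.
  - by move=> k; rewrite coef_poly; case: ifP.
  - apply: contra_neq p0 => R0; apply: (map_poly_inj i).
    by rewrite -Rp R0 !rmorph0.
  - by rewrite Rp.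
case: (ex_minnP exann) => n /asboolP[Q [SQ Q0 Qa <-]] Qmin.
pose l := lead_coef Q.
have [lQ1 lQ2] : l.1 != 0 /\ l.2 != 0 by apply: (S_eq0 _ (SQ _)); rewrite lead_coef_eq0.
have sQ2 : size (map_poly snd Q) = size Q by apply: size_map_poly_id0.
have [b /rootP Qb] : exists b, root (map_poly snd Q) b.
  apply/closed_rootP; rewrite sQ2; apply/negP => /size_poly1P[c c0 QE].
  move: lQ1 Qa; rewrite /l QE lead_coefC map_polyC hornerC /= => c10 c1.
  by rewrite c1 eqxx in c10.
(* [S] need not be a field, so [Q] cannot be made monic: pseudo-division by [Q] is used, and it is
   enough that both components of its leading coefficient are nonzero. *)
have main m (R : {poly L * M}) : (size R <= m)%N -> coefs_in R ->
    (map_poly fst R).[a] = 0 -> (map_poly snd R).[b] = 0.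
  elim: m R => [|m IH] R sR SR Ra.
    by move: sR; rewrite leqn0 size_poly_eq0 => /eqP->; rewrite rmorph0 horner0.
  have [->|R0] := eqVneq R 0; first by rewrite rmorph0 horner0.
  have QR : (size Q <= size R)%N by apply: Qmin; apply/asboolP; exists R.
  pose T := l%:P * R - (lead_coef R)%:P * 'X^(size R - size Q) * Q.
  have ST : coefs_in T.
    apply: coefs_inB; first by apply: coefs_inM => //; apply/coefs_inC/SQ.
    by apply: coefs_inM => //; apply: coefs_inM; [apply/coefs_inC/SR|].
  have Ta : (map_poly fst T).[a] = 0.
    by rewrite !(rmorphB, rmorphM) /= !hornerE Ra Qa !mulr0 subrr.
  have sT : (size T <= m)%N.
    have sR1 : size R = (size R).-1.+1 by rewrite prednK // size_poly_gt0.
    have sQ1 : size Q = (size Q).-1.+1 by rewrite prednK // size_poly_gt0.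
    apply: (@leq_trans (size R).-1); last by rewrite -ltnS -sR1.
    apply/leq_sizeP => k kR; rewrite coefB -mulrA !coefCM coefXnM ltnNge.
    have -> : (size R - size Q <= k)%N.
      by rewrite (leq_trans _ kR) // sR1 [in X in (_ - X)%N]sQ1 subSS leq_subr.
    rewrite /=; move: kR; rewrite leq_eqVlt => /orP[/eqP<-|kR].
      have -> : ((size R).-1 - (size R - size Q) = (size Q).-1)%N.
        rewrite sR1 sQ1 subSS /= subKn // -ltnS -sR1 -sQ1.
        exact: QR.
      by rewrite mulrC subrr.
    rewrite [R`_k]nth_default; last by rewrite sR1.
    rewrite nth_default ?mulr0 ?subrr // leq_subRL.
      by rewrite subnK // sR1.
    by rewrite (leq_trans _ kR) // sR1 [in X in (_ - X)%N]sQ1 subSS ltnW // ltnS leq_subr.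
  have := IH T sT ST Ta; rewrite !(rmorphB, rmorphM) /= !hornerE Qb mulr0 subr0.
  by rewrite map_polyC hornerC => /eqP; rewrite mulf_eq0 (negPf lQ2) => /eqP.
exists b, (fun u => exists2 R, coefs_in R & R.[(a, b)] = u); split.
- split.
  + move=> x; exists (i x, s x)%:P; last by rewrite hornerC.
    exact: coefs_inC.
  + move=> _ _ [R SR <-] [R' SR' <-]; exists (R - R'); first exact: coefs_inB.
    by rewrite hornerD hornerN.
  + move=> _ _ [R SR <-] [R' SR' <-]; exists (R * R'); first exact: coefs_inM.
    by rewrite hornerM.
  + move=> y [R SR RE].
    have := fstE R (a, b); rewrite RE /= => /esym Ra.
    have := sndE R (a, b); rewrite RE /= => ->.
    exact: (main (size R)).
- move=> u Su; exists u%:P; last by rewrite hornerC.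
  exact: coefs_inC.
- exists 'X; last by rewrite hornerX.
  by have := coefs_inXn 1; rewrite expr1.
Qed.

End OneStep.

Lemma rmorph_extend : exists t : {rmorphism L -> M}, forall x, t (i x) = s x.
Proof.
pose P (S : set (L * M)) := S = set0 \/ partial_extension S.
have base : partial_extension (fun u => exists2 x, True & (i x, s x) = u).
  split.
  - by move=> x; exists x.
  - by move=> _ _ [x _ <-] [y _ <-]; exists (x - y); rewrite // !rmorphB.
  - by move=> _ _ [x _ <-] [y _ <-]; exists (x * y); rewrite // !rmorphM.
  - move=> y [x _ [/eqP]]; rewrite fmorph_eq0 => /eqP-> <-.
    by rewrite rmorph0.
have [F FP Ftot|S [PS Smax]] := @Zorn_bigcup _ P.
  have [[S0 [FS0 S0n]]|F0] := pselect (exists S, F S /\ S != set0); last first.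
    left; apply/seteqP; split=> // u [S FS Su]; apply: F0.
    by exists S; split=> //; apply/set0P; exists u.
  have good S u : F S -> S u -> partial_extension S.
    by move=> /FP[->|//].
  have [u0 S0u] : exists u, S0 u by apply/set0P.
  right; split.
  - by move=> x; exists S0 => //; case: (good _ _ FS0 S0u).
  - move=> u v [S FS Su] [T FT Tv].
    have [ST|TS] := Ftot _ _ FS FT.
      by exists T => //; case: (good _ _ FT Tv) => _ + _ _; apply=> //; apply: ST.
    by exists S => //; case: (good _ _ FS Su) => _ + _ _; apply=> //; apply: TS.
  - move=> u v [S FS Su] [T FT Tv].
    have [ST|TS] := Ftot _ _ FS FT.
      by exists T => //; case: (good _ _ FT Tv) => _ _ + _; apply=> //; apply: ST.
    by exists S => //; case: (good _ _ FS Su) => _ _ + _; apply=> //; apply: TS.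
  - by move=> y [S FS Sy]; case: (good _ _ FS Sy) => _ _ _; apply.
have Sext : partial_extension S.
  case: PS => // S0; case: (Smax _ _ (or_intror base)).
  rewrite S0; split=> // /(_ (i 0, s 0)) H; apply: H; by exists 0.
have /choice[t tS] : forall a, exists b, S (a, b).
  move=> a; apply: contrapT => aS.
  have [b [S' [S'ext SS' S'ab]]] := partial_extension_step Sext a.
  case: (Smax S' _ (or_intror S'ext)); split=> // S'S.
  by apply: aS; exists b; apply: S'S.
have [SK SB SM S_fun] := Sext.
have tE a b : S (a, b) -> b = t a.
  move=> Sab; apply/eqP; rewrite -subr_eq0; apply/eqP; apply: S_fun.
  by rewrite -[0](subrr a); apply: (SB _ _ Sab (tS a)).
have tB : zmod_morphism t.
  by move=> x y; rewrite -(tE _ _ (SB _ _ (tS x) (tS y))).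
have tM : monoid_morphism t.
  split; first by rewrite -(rmorph1 i) -(tE _ _ (SK 1)) rmorph1.
  by move=> x y; rewrite -(tE _ _ (SM _ _ (tS x) (tS y))).
pose tz := GRing.isZmodMorphism.Build L M t tB.
pose tm := GRing.isMonoidMorphism.Build L M t tM.
pose T : {rmorphism L -> M} := HB.pack t tz tm.
by exists T => x; symmetry; exact: tE.
Qed.

End Extension.

(** * Continuity *)

Section Continuity.
Variables (K : fieldType) (L : closedFieldType) (iota : {rmorphism K -> L}).
Local Notation M := (Mring iota).
Local Open Scope classical_set_scope.

Lemma cvg_initial (S : choiceType) (T : topologicalType) (f : S -> T)
    (F : set_system S) (s : S) : Filter F ->
  f @ F --> f s -> F --> (s : initial_topology f).
Proof.
move=> FF fF A [_ [[B Bop <-] Bs sBA]].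
apply: filterS sBA _; apply: fF; exact: open_nbhs_nbhs.
Qed.

Definition t_vanish_upto (n : nat) : set M :=
  [set h | forall i, (i <= n)%N -> t_ iota i h = 0].

(** The filter generated by the sets [t_vanish_upto n] converges to 0, which is checked one discrete
    coordinate at a time. *)
Lemma nbhs0_vanish (A : set M) : nbhs (0 : M) A -> exists n, t_vanish_upto n `<=` A.
Proof.
pose F := filter_from setT t_vanish_upto.
have FF : Filter F.
  apply: filter_from_filter; first by exists 0%N.
  move=> m n _ _; exists (maxn m n) => // h H; split=> i im;
    by apply: H; rewrite leq_max im ?orbT.
suff : F --> (0 : M) by move=> /[apply] -[n _ ?]; exists n.
apply: (@cvg_initial M _ (@t_family K L iota)).
apply/cvg_sup => i; apply: (@cvg_initial _ (discrete_topology K)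
  (fun f : prod_topology (fun _ : nat => discrete_topology K) => f i)).
move=> B /= B0; exists i => // h H.
by rewrite /= /t_family H // -(raddf0 (t_ iota i)); exact: nbhs_singleton B0.
Qed.

Lemma open_t_eq0 k : open ([set g | t_ iota k g = 0] : set M).
Proof.
exists [set f | f k = (0 : K)] => //.
pose T := prod_topology (fun _ : nat => discrete_topology K).
have cont : continuous (fun f : T => f k).
  move=> f; have H := proj1 (@cvg_sup _ _ _ (nbhs f) f (nbhs_filter f)) (fun A => id) k.
  move=> A Af; apply: H.
  exact: (@initial_continuous _ (discrete_topology K) (fun f : T => f k)).
have /continuousP/(_ [set (0 : K)]) := cont.
by apply; apply: discrete_open.
Qed.

Lemma continuous_t_vanish (phi : {rmorphism M -> M}) : continuous phi ->
  forall k, exists n, forall h, t_vanish_upto n h -> t_ iota k (phi h) = 0.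
Proof.
move=> cphi k.
apply: (@nbhs0_vanish (phi @^-1` [set g | t_ iota k g = 0])).
apply: (cphi 0); apply: open_nbhs_nbhs; split; first exact: open_t_eq0.
by rewrite /= !raddf0.
Qed.
End Continuity.

(** * Endomorphisms of M_K *)

Section PowerSumHoms.
Variables (K : fieldType) (L : closedFieldType) (iota : {rmorphism K -> L}).
Hypothesis char0 : [pchar K] =i pred0.
Local Notation M := (Mring iota).

Lemma t_roots k (h : M) : iota (t_ iota k h) =
  \sum_(a <- alg_roots iota (Mnum h)) a ^+ k
  - \sum_(a <- alg_roots iota (Mden h)) a ^+ k.
Proof.
have [mn md _ _] := lowest_termsP h.
by rewrite t_.unlock rmorphB /= !power_sumE.
Qed.

Lemma t0_int (h : M) : exists z : int, t_ iota 0 h = z%:~R.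
Proof.
exists ((size (alg_roots iota (Mnum h)))%:Z - (size (alg_roots iota (Mden h)))%:Z).
apply: (fmorph_inj iota); rewrite t_roots rmorph_int rmorphB /= -!pmulrn.
have E (s : seq L) : \sum_(a <- s) a ^+ 0 = (size s)%:R.
  under eq_bigr do rewrite expr0.
  by rewrite big_const_seq count_predT iter_addr_0.
by rewrite !E.
Qed.

(** Each of the $i$ roots of $X^i-c/i$ has $i$-th power $c/i$. *)
Lemma t_surj i c : (0 < i)%N -> exists h : M, t_ iota i h = c.
Proof.
move=> i0; have iK : i%:R != 0 :> K by rewrite (pchar0_natr_neq0 char0).
pose p : {poly K} := 'X^i - (c / i%:R)%:P.
have mp : p \is monic by rewrite /p -(prednK i0) monicXnsubC.
exists (cls iota p%:F); rewrite t_cls //; apply: (fmorph_inj iota).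
rewrite power_sumE //.
transitivity (\sum_(a <- alg_roots iota p) iota (c / i%:R)).
  rewrite big_seq [RHS]big_seq; apply: eq_bigr => a.
  rewrite -root_prod_XsubC -alg_rootsE // /p rmorphB /= map_polyXn map_polyC.
  by rewrite rootE hornerD hornerN hornerXn hornerC subr_eq0 => /eqP.
have sp : size (alg_roots iota p) = i.
  apply: succn_inj; rewrite -(size_prod_XsubC _ id) -alg_rootsE // size_map_poly.
  by rewrite /p -(prednK i0) size_XnsubC.
rewrite big_const_seq count_predT sp iter_addr_0 -rmorphMn.
by rewrite -mulr_natr divfK.
Qed.

(* The kernel of [f] is a prime ideal containing the finite intersection of   *)
(* the kernels of t_0, ..., t_n, hence it contains one of these kernels.      *)
Lemma hom_factor (f : {rmorphism M -> K}) n :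
  (forall h, t_vanish_upto n h -> f h = 0) ->
  exists (m : nat) (s : {rmorphism K -> K}),
    (forall h, f h = s (t_ iota m h)) /\ (m = 0%N -> s =1 id).
Proof.
move=> fn; have [i fi] : exists i, forall h, t_ iota i h = 0 -> f h = 0.
  apply: contrapT => H.
  have {}H i : exists h, t_ iota i h = 0 /\ f h != 0.
    apply: contrapT => Hi; apply: H; exists i => h hi.
    by apply/eqP; apply: contraT => fh; case: Hi; exists h.
  have [h [sh]] : exists h, t_vanish_upto n h /\ f h != 0.
    elim: n {fn} => [|n [g [sg fg]]].
      by have [h [h0 fh]] := H 0%N; exists h; split=> // i; rewrite leqn0 => /eqP->.
    have [h [hn fh]] := H n.+1; exists (g * h); split; last first.
      by rewrite rmorphM mulf_neq0.
    move=> i; rewrite leq_eqVlt => /orP[/eqP->|]; first by rewrite rmorphM /= hn mulr0.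
    by rewrite ltnS => /sg gi; rewrite rmorphM /= gi mul0r.
  by rewrite fn ?eqxx.
(* For $i=0$ all values of $t_0$ are integers, which ring morphisms preserve, so $f=t_0$. For $i>0$,
   $f(h)$ depends only on $t_i(h)$, so composing $f$ with a section of $t_i$ gives a ring
   morphism. *)
have [i0|i0] := posnP i.
  exists 0%N, idfun; split=> // h; have [z hz] := t0_int h.
  rewrite /= hz -(rmorph_int f) -[h in LHS](subrK z%:~R) rmorphD.
  by rewrite (fi (h - z%:~R)) ?add0r // i0 rmorphB /= hz rmorph_int subrr.
have [g gE] := choice (fun c => t_surj c i0).
have fE h h' : t_ iota i h = t_ iota i h' -> f h = f h'.
  move=> E; apply/eqP; rewrite -subr_eq0 -rmorphB; apply/eqP/fi.
  by rewrite rmorphB /= E subrr.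
have sB : zmod_morphism (f \o g).
  by move=> x y; rewrite /= -rmorphB; apply: fE; rewrite rmorphB /= !gE.
have sM : monoid_morphism (f \o g).
  split=> [|x y]; first by rewrite /= -[RHS](rmorph1 f); apply: fE; rewrite gE rmorph1.
  by rewrite /= -rmorphM; apply: fE; rewrite rmorphM /= !gE.
pose sz := GRing.isZmodMorphism.Build K K (f \o g) sB.
pose sm := GRing.isMonoidMorphism.Build K K (f \o g) sM.
pose s : {rmorphism K -> K} := HB.pack (f \o g) sz sm.
exists i, s; split; last by move=> iE; rewrite iE in i0.
by move=> h; apply: fE; rewrite gE.
Qed.

(** Zero roots are dropped so that all ratios are units; this loses only the exponent $k=0$. *)
Definition signed_roots (h : M) : seq (int * L) :=
  [seq (1, a) | a <- alg_roots iota (Mnum h) & a != 0] ++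
  [seq (-1, a) | a <- alg_roots iota (Mden h) & a != 0].

Lemma signed_roots_neq0 h i : i \in signed_roots h -> i.2 != 0.
Proof.
rewrite mem_cat => /orP[] /mapP[a]; rewrite mem_filter => /andP[a0 _] -> //.
Qed.

Lemma expsum_signed_roots h k : (0 < k)%N ->
  expsum (signed_roots h) k = iota (t_ iota k h).
Proof.
move=> k0; rewrite t_roots /expsum big_cat !big_map !big_filter /=.
have E (s : seq L) (z : int) :
    \sum_(a <- s | a != 0) z%:~R * a ^+ k = z%:~R * \sum_(a <- s) a ^+ k.
  rewrite mulr_sumr [LHS]big_mkcond; apply: eq_bigr => a _ /=.
  by case: eqP => //= ->; rewrite expr0n eqn0Ngt k0 mulr0.
by rewrite !E mul1r mulN1r.
Qed.

Lemma t_linear k (a : K) : t_ iota k (cls iota ('X - a%:P)%:F) = a ^+ k.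
Proof.
rewrite t_cls ?monicXsubC //; apply: (fmorph_inj iota).
rewrite power_sumE ?monicXsubC // (perm_big [:: iota a]).
  by rewrite big_seq1 rmorphXn.
apply: alg_roots_perm; first exact: monicXsubC.
by rewrite big_seq1 rmorphB /= map_polyX map_polyC.
Qed.

End PowerSumHoms.

(** * Endomorphisms of algebraic extensions of the rationals, and their lifts *)

Section AlgebraicOverRat.
Variables (K : fieldType) (j : {rmorphism rat -> K}).
Hypothesis K_alg : algebraic_ext j.

Lemma rat_ext_pchar0 : [pchar K] =i pred0.
Proof. by move=> p; rewrite (fmorph_pchar j) Num.Theory.pchar_num. Qed.

Lemma rat_ext_fixed (s : {rmorphism K -> K}) x : s (j x) = j x.
Proof. by rewrite [RHS](fmorph_eq_rat j) -(fmorph_eq_rat (s \o j)). Qed.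

Lemma rat_ext_root (s : {rmorphism K -> K}) p x :
  root (map_poly j p) x -> root (map_poly j p) (s x).
Proof.
rewrite -(fmorph_root s) -map_poly_comp; congr (root _ _).
by apply: eq_map_poly => y; apply: rat_ext_fixed.
Qed.

(** The orbit of $y$ stays among the finitely many roots of a polynomial, so it repeats; by
    injectivity $y=s^r(y)$ for some $r>0$. *)
Lemma rat_ext_endo_bij (s : {rmorphism K -> K}) : bijective s.
Proof.
have /choice[g gE] : forall y, exists x, s x = y.
  move=> y; have [p p0 py] := K_alg y.
  pose orb := mkseq (fun n => iter n s y) (size p).
  have pj0 : map_poly j p != 0 by rewrite map_poly_eq0.
  have /(uniqPn 0)[m [n [mn]]] : ~~ uniq orb.
    apply/negP => uo; have := max_poly_roots pj0 _ uo.
    rewrite size_map_poly size_mkseq ltnn => H; have // : false; apply: H.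
    apply/allP => _ /mapP[n _ ->]; elim: n => //= n; exact: rat_ext_root.
  rewrite size_mkseq => ns; rewrite !nth_mkseq //; last exact: ltn_trans ns.
  rewrite -(subnKC mn) addSnnS iterD.
  have inj : injective (iter m s).
    by elim: m {mn} => //= m IH x x' /fmorph_inj/IH.
  by move/inj => {1}->; exists (iter (n - m.+1) s y).
by exists g => // x; apply: (fmorph_inj s).
Qed.

End AlgebraicOverRat.

Lemma aut_lift (K : fieldType) (L : closedFieldType) (iota : {rmorphism K -> L})
    (s : {rmorphism K -> K}) : algebraic_ext iota -> bijective s ->
  exists t : {rmorphism L -> L}, aut_extends iota s t.
Proof.
move=> L_alg [g sK gK].
have [t tE] := rmorph_extend (iota \o s) L_alg.
exists t; split; last exact: tE.
have /choice[u uE] : forall y, exists x, t x = y.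
  move=> y; have [p p0 /rootP py] := L_alg y.
  have g0 : g 0 = 0 by apply: (fmorph_inj s); rewrite gK rmorph0.
  (* The coefficients of [p] are pulled back along [s], so that [t] carries the roots of [q] onto
     those of [p]. *)
  pose q := map_poly g p.
  have qE : map_poly t (map_poly iota q) = map_poly iota p.
    by apply/polyP => k; rewrite !coef_map /= coef_map_id0 // tE /= gK.
  have [r rE] := closed_field_poly_normal (map_poly iota q).
  have : root (map_poly t (map_poly iota q)) y by rewrite qE; apply/rootP.
  rewrite rE map_polyZ rmorph_prod /= rootZ; last first.
    rewrite fmorph_eq0 lead_coef_eq0; apply: contra_neq p0 => E.
    by apply: (map_poly_inj iota); rewrite -qE E !rmorph0.
  under eq_bigr do rewrite rmorphB /= map_polyX map_polyC /=.
  by rewrite -(big_map t predT (fun z => 'X - z%:P)) root_prod_XsubC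
     => /mapP[x _ ->]; exists x.
by exists u => // x; apply: (fmorph_inj t).
Qed.

(** With signs $+1$ on [r] and $-1$ on [s], [geom_indep] kills the difference of the multiplicities
    of each element, an integer that embeds faithfully in characteristic 0. *)
Lemma power_sums_perm (L : fieldType) (r s : seq L) : [pchar L] =i pred0 ->
  (forall k, \sum_(a <- r) a ^+ k = \sum_(a <- s) a ^+ k) -> perm_eq r s.
Proof.
move=> char0 rs.
pose C (i : bool * L) : L := if i.1 then 1 else -1.
have H x : \sum_(i <- [seq (true, a) | a <- r] ++ [seq (false, a) | a <- s]
    | i.2 == x) C i = 0.
  apply: (geom_indep (b := snd)) => k; rewrite big_cat !big_map /C /=.
  under eq_bigr do rewrite mul1r.
  under [X in _ + X]eq_bigr do rewrite mulN1r.
  by rewrite sumrN rs subrr.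
apply/allP => x _ /=; have := H x; rewrite big_cat !big_map /C /= sumrN.
rewrite !big_const_seq !iter_addr_0 => /eqP; rewrite !pmulrn -mulrzBr.
by rewrite (pchar0_intr_eq0 char0) subr_eq0 => /eqP[->].
Qed.

(** * Exponents and automorphisms attached to a continuous endomorphism *)

Section Endomorphism.
Variables (K : fieldType) (j : {rmorphism rat -> K}).
Hypothesis K_alg : algebraic_ext j.
Variables (L : closedFieldType) (iota : {rmorphism K -> L}).
Local Notation M := (Mring iota).
Variable phi : {rmorphism M -> M}.
Hypothesis phi_cont : continuous phi.

Let charK : [pchar K] =i pred0 := rat_ext_pchar0 j.
Let charL : [pchar L] =i pred0.
Proof. by move=> p; rewrite (fmorph_pchar iota) charK. Qed.

Lemma t_phi_factor : exists (n : nat -> nat) (s : nat -> {rmorphism K -> K}),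
  [/\ forall k h, t_ iota k (phi h) = s k (t_ iota (n k) h),
      forall k, n k = 0%N -> s k =1 id & n 0%N = 0%N].
Proof.
have /choice[ns nsP] : forall k, exists ns : nat * {rmorphism K -> K},
    (forall h, t_ iota k (phi h) = ns.2 (t_ iota ns.1 h)) /\
    (ns.1 = 0%N -> ns.2 =1 id).
  move=> k; have [n small0] := continuous_t_vanish phi_cont k.
  have [m [s sP]] := hom_factor charK (f := t_ iota k \o phi) small0.
  by exists (m, s).
exists (fun k => (ns k).1), (fun k => (ns k).2).
split=> [k|k|]; try by case: (nsP k).
(* If $n_0>0$, some $h$ has $t_{n_0}(h)=1/2$, so the integer $t_0(\phi(h))$ would equal
   $s_0(1/2)=1/2$. *)
apply/eqP; rewrite -leqn0 leqNgt; apply/negP => n0.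
have [h hE] := t_surj iota charK 2^-1 n0.
have [z zE] := t0_int (phi h).
have := proj1 (nsP 0%N) h; rewrite zE hE fmorphV rmorph_nat => E.
have two0 : 2 != 0 :> K by apply: (pchar0_natr_neq0 charK (n := 2)).
apply: (half_not_integral charK); rewrite -E; exact: integral_id.
Qed.

Section Exponents.
Variables (n : nat -> nat) (s : nat -> {rmorphism K -> K}).
Hypothesis tphi : forall k h, t_ iota k (phi h) = s k (t_ iota (n k) h).
Hypothesis n0 : n 0%N = 0%N.

Let w (a : K) k : L := iota (s k a) ^+ n k.

(** The sequence $w_k(a)$ lists the power sums of $\phi([x-a])$, and its inverse those of
    $\phi([x-a^{-1}])$, so [expsum_unit] applies to their roots. *)
Let unit_structure (a : K) : a != 0 -> exists f N, [/\ f != 0, (0 < N)%N,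
    forall k, (0 < k)%N -> w a (k + N)%N = w a k * f ^+ N,
    forall k, (0 < k)%N -> integralOver intr (w a k / f ^+ k) &
    forall k, (0 < k)%N -> integralOver intr (f ^+ k / w a k)].
Proof.
move=> a0; pose g (b : K) := phi (cls iota ('X - b%:P)%:F).
have wE b k : (0 < k)%N -> expsum (signed_roots (g b)) k = w b k.
  by move=> k0; rewrite expsum_signed_roots // tphi t_linear !rmorphXn.
have wV k : w a^-1 k = (w a k)^-1 by rewrite /w !fmorphV exprVn.
have w0 k : w a k != 0 by rewrite expf_neq0 // !fmorph_eq0.
have [||k k0|f [N [f0 N0 fN I1 I2]]] := @expsum_unit L charL (signed_roots (g a))
    (signed_roots (g a^-1)).
- by move=> i; apply: signed_roots_neq0.
- by move=> i; apply: signed_roots_neq0.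
- by rewrite !wE // wV divff.
exists f, N; split=> // k k0.
- by rewrite -!wE ?fN // addn_gt0 k0.
- by rewrite -wE //; apply: I1.
- by rewrite -wV mulrC -wE //; apply: I2.
Qed.

(** For $a=2$ every $w_k$ is a power of 2, and so is $f^N$ up to a denominator. Integrality in both
    directions gives $n_iN+n_1i=n_{1+N}\,i$; the case $i=1$ eliminates $n_{1+N}$. *)
Lemma exponents_linear k : n k = (n 1%N * k)%N.
Proof.
have two0 : 2 != 0 :> K by apply: (pchar0_natr_neq0 charK (n := 2)).
have twoL : 2 != 0 :> L by apply: (pchar0_natr_neq0 charL (n := 2)).
have [f [N [f0 N0 fN I1 I2]]] := unit_structure two0.
have w2 i : w 2 i = 2 ^+ n i by rewrite /w !rmorph_nat.
have fE : f ^+ N = 2 ^+ n (1 + N)%N / 2 ^+ n 1%N.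
  by rewrite -!w2 fN // mulrAC divff ?mul1r // w2 expf_neq0.
have E i : (0 < i)%N -> (n i * N + n 1%N * i)%N = (n (1 + N) * i)%N.
  move=> i0; have fiE : f ^+ (i * N) = 2 ^+ (n (1 + N)%N * i) / 2 ^+ (n 1%N * i).
    by rewrite mulnC !exprM fE expr_div_n.
  have IX x : integralOver (intr : int -> L) x -> integralOver (intr : int -> L) (x ^+ N).
    move=> Ix; elim: N {fN N0 fE fiE} => [|m IH]; first exact: integral1.
    by rewrite exprS; apply: integral_mul.
  apply/eqP; rewrite eqn_leq; apply/andP; split; apply: (integral_pow2_leq charL).
  - have := IX _ (I2 i i0); rewrite w2 expr_div_n -!exprM fiE.
    by rewrite [2 ^+ (_ + _)]exprD invfM -mulrA [X in _ * X]mulrC.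
  - have := IX _ (I1 i i0); rewrite w2 expr_div_n -!exprM fiE.
    by rewrite [2 ^+ (_ + _)]exprD invf_div mulrA.
have [->|k0] := posnP k; first by rewrite n0 muln0.
have E1 := E 1%N isT; rewrite !muln1 in E1.
apply/eqP; rewrite -(eqn_pmul2r N0) -(eqn_add2r (n 1%N * k)) E // -E1.
by rewrite mulnDl mulnAC.
Qed.

Lemma automorphisms_constant k : (0 < n 1%N)%N -> (0 < k)%N -> s k =1 s 1%N.
Proof.
move=> m0 k0; move=> x; apply: (fmorph_inj iota).
apply: (rmorph_eq_torsion (f := iota \o s k) (g := iota \o s 1%N) K_alg charK).
move=> a a0 /=.
have [f [N [f0 N0 fN _ _]]] := unit_structure a0.
(* Since $n_i=n_1i$, the power $v_i^i$ is $w_i/f^i$, which has period [N]; and $v_i$ takes finitely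
   many values because each $s_i(a)$ is a conjugate of $a$. *)
pose v i : L := iota (s i a) ^+ n 1%N / f.
have tv i : (0 < i)%N -> torsion (v i).
  have [p p0 pa] := K_alg a.
  have [r rE] := closed_field_poly_normal (map_poly iota (map_poly j p)).
  apply: (@pigeonhole_torsion L [seq y ^+ n 1%N / f | y <- r] v N N0).
  - move=> l _; apply: (map_f (fun y => y ^+ n 1%N / f)).
    rewrite -root_prod_XsubC -(rootZ _ (a := lead_coef (map_poly iota (map_poly j p)))).
      by rewrite -rE fmorph_root rat_ext_root.
    by rewrite lead_coef_eq0 !map_poly_eq0.
  - by move=> l _; rewrite mulf_neq0 ?invr_eq0 // expf_neq0 // !fmorph_eq0.
  - move=> l l0; have := fN l l0; rewrite /w /v.
    rewrite (exponents_linear (l + N)) (exponents_linear l).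
    rewrite !expr_div_n -!exprM => ->.
    by rewrite [f ^+ (l + N)]exprD; field; rewrite !expf_neq0.
apply: (torsion_root m0).
have -> : (iota (s k a) / iota (s 1%N a)) ^+ n 1%N = v k / v 1%N.
  by rewrite /v expr_div_n; field; rewrite f0 expf_neq0 // !fmorph_eq0.
by apply: torsionM; [apply: tv | apply/torsionV/tv].
Qed.
End Exponents.

Lemma t_phi_power : exists (m : nat) (s : {rmorphism K -> K}),
  forall k h, t_ iota k (phi h) = s (t_ iota (m * k)%N h).
Proof.
have [n [s [tphi s_id n0]]] := t_phi_factor.
have n_lin := exponents_linear tphi n0.
exists (n 1%N), (s 1%N) => k h; have [->|k0] := posnP k.
  rewrite muln0 tphi n0 s_id //; have [z ->] := t0_int h.
  by rewrite rmorph_int.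
(* If $n_1=0$, every $n_k$ vanishes, and then every $s_k$ is the identity. *)
rewrite tphi -n_lin; have [n1|n1] := posnP (n 1%N).
  by rewrite !s_id // n_lin n1.
by rewrite (automorphisms_constant tphi n0 n1 k0).
Qed.

End Endomorphism.

Theorem theorem1p1 (K : fieldType) (j : {rmorphism rat -> K})
    (K_algebraic : algebraic_ext j)
    (Kbar : closedFieldType) (iota : {rmorphism K -> Kbar})
    (Kbar_algebraic : algebraic_ext iota)
    (phi : {rmorphism Mring iota -> Mring iota})
    (phi_continuous : continuous phi) :
  (exists (k s : nat) (sigma : {rmorphism K -> K}),
     [/\ bijective sigma,
         exists tau : {rmorphism Kbar -> Kbar}, aut_extends iota sigma tau
       & forall tau : {rmorphism Kbar -> Kbar}, aut_extends iota sigma tau ->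
         forall p : {poly K}, p \is monic ->
         exists (e : int) (r : {poly K}),
           [/\ e%:~R = \sum_(a <- alg_roots iota p) (a ^+ s - 1) :> Kbar,
               map_poly iota r =
                 \prod_(a <- alg_roots iota p) ('X - (tau a ^+ k)%:P)
             & phi (cls iota p%:F) = cls iota ('X%:F ^ e * r%:F)]])
  \/
  ((forall (h : Mring iota) (z : Kbar), is_root (phi h) z ->
      exists n : nat, (0 < n)%N /\ z ^+ n = 1)
   /\ (finite_ext j ->
       exists N : nat, (1 <= N)%N /\
         forall (h : Mring iota) (z : Kbar), is_root (phi h) z -> z ^+ N = 1)).
Proof.
left; have [m [sigma tphi]] := t_phi_power K_algebraic phi_continuous.
have sigma_bij := rat_ext_endo_bij K_algebraic sigma.
exists m, 0%N, sigma; split=> //; first exact: aut_lift.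
move=> tau [_ tauE] p mp; set h := phi (cls iota p%:F).
have charL : [pchar Kbar] =i pred0.
  by move=> q; rewrite (fmorph_pchar iota) (rat_ext_pchar0 j).
have [mn md cop hE] := lowest_termsP h.
pose img := [seq tau a ^+ m | a <- alg_roots iota p].
(* Equality of all power sums, with the denominator moved to the other side, becomes equality of
   multisets of roots. *)
have roots_eq : perm_eq (alg_roots iota (Mnum h)) (alg_roots iota (Mden h) ++ img).
  apply: (power_sums_perm charL) => k.
  rewrite big_cat /= addrC; apply/eqP; rewrite -subr_eq -t_roots tphi -tauE.
  rewrite t_cls // power_sumE // rmorph_sum big_map; apply/eqP/eq_bigr => a _.
  by rewrite rmorphXn exprM.
have numE : map_poly iota (Mnum h) =
    map_poly iota (Mden h) * \prod_(a <- img) ('X - a%:P).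
  by rewrite alg_rootsE // (perm_big _ roots_eq) big_cat -alg_rootsE.
(* The denominator divides the numerator and is coprime to it, so $\phi([p])$ is the class of a
   polynomial. *)
have den1 : Mden h = 1.
  apply/eqP; rewrite -(eqp_monic md (monic1 K)) -size_poly_eq1 -coprimepp.
  by apply: coprimep_dvdr cop; rewrite -(dvdp_map iota) numE dvdp_mulr.
exists 0, (Mnum h); split.
- by rewrite big1 // => a _; rewrite expr0 subrr.
- by rewrite numE den1 rmorph1 mul1r big_map.
- by rewrite expr0z mul1r -/h; apply: ratfun_inj;
    rewrite hE den1 tofrac1 divr1 ratfun_cls //; apply: monic_ratioF.
Qed.
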